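(* Fix an integer $k\ge2$ and $p\in(0,1/2]$. There is an absolute constant $C>0$ such that the following holds for every $n$ with $pn$ an integer. Let $f\colon\binom{[n]}{pn}\to\{\pm1\}$ satisfy $\|f^{>k}\|^2=\epsilon$. There exists a function $h\colon\binom{[n]}{pn}\to\{\pm1\}$ of degree at most $k$ depending on $O_{k,p}(1)$ coordinates (that is, invariant under permutations of all other coordinates) such that $$\|f-h\|^2=O_{p,k}\left(\epsilon^{1/C}+\frac{1}{n^{1/C}}\right).$$
   Context: $[n]=\{1,\dots,n\}$. The slice is $\binom{[n]}{m}=\{x\in\{0,1\}^n: x_1+\cdots+x_n=m\}$; norms $\|g\|^2=\mathbb{E}[g^2]$ are with respect to the uniform distribution on $\binom{[n]}{pn}$. A polynomial is multilinear if $\partial^2 f/\partial x_i^2=0$ for all $i$, and harmonic if $\sum_{i=1}^n\partial f/\partial x_i=0$. Every function $f$ on $\binom{[n]}{m}$ is represented by a unique harmonic multilinear polynomial of degree at most $\min(m,n-m)$; the degree of $f$ is the degree of this polynomial, $f^{=d}$ is its degree-$d$ homogeneous part, and $f^{>k}=\sum_{d>k}f^{=d}$. The notation $O_{p,k}(\cdot)$ hides a constant depending only on $p$ and $k$ (continuously on $p$). The constant $C$ does not depend on $p,k,n,f$. *)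

(* Defs.v *)
From HB Require Import structures.
From mathcomp Require Import all_boot all_order all_fingroup all_algebra.
From mathcomp Require Import mpoly.
From mathcomp Require Import classical_sets reals.

Set Implicit Arguments.
Unset Strict Implicit.
Unset Printing Implicit Defensive.

Import GRing.Theory Num.Theory.
Local Open Scope ring_scope.

Definition slice (n m : nat) :=
  {x : {ffun 'I_n -> bool} | (\sum_(i < n) x i == m)%N}.

Definition point_coords (R : realType) n m (x : slice n m) : 'I_n -> R :=
  fun i => (val x i)%:R.

Definition eval_slice (R : realType) n m (P : {mpoly R[n]}) : slice n m -> R :=
  fun x => P.@[point_coords R x].

Definition norm2 (R : realType) n m (g : slice n m -> R) : R :=
  (\sum_(x : slice n m) g x ^+ 2) / #|{: slice n m}|%:R.

Definition sign_valued (R : realType) n m (f : slice n m -> R) : Prop :=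
  forall x, f x = 1 \/ f x = -1.

Definition multilinear (R : realType) n (P : {mpoly R[n]}) : Prop :=
  forall i : 'I_n, mderiv i (mderiv i P) = 0.

Definition harmonic (R : realType) n (P : {mpoly R[n]}) : Prop :=
  \sum_(i < n) mderiv i P = 0.

(* [msize] is the total degree plus one, and is 0 on the zero polynomial. *)
Definition represents (R : realType) n m (P : {mpoly R[n]})
    (f : slice n m -> R) : Prop :=
  [/\ multilinear P, harmonic P, (msize P <= (minn m (n - m)).+1)%N
    & forall x, eval_slice P x = f x].

(* For m <= n exactly one polynomial represents f; the default value 0 of
   [xget] plays no role. *)
Definition harmonic_poly (R : realType) n m (f : slice n m -> R) :
    {mpoly R[n]} :=
  xget 0 [set P | represents P f]%classic.

Definition slice_degree (R : realType) n m (f : slice n m -> R) : nat :=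
  (msize (harmonic_poly f)).-1.

Definition homog_part (R : realType) n m (d : nat) (f : slice n m -> R) :
    slice n m -> R :=
  eval_slice (pihomog mdeg d (harmonic_poly f)).

(* Homogeneous parts of degree larger than [slice_degree f] vanish, so the sum
   over all d > k is finite. *)
Definition high_part (R : realType) n m (k : nat) (f : slice n m -> R) :
    slice n m -> R :=
  fun x => \sum_(k.+1 <= d < (slice_degree f).+1) homog_part d f x.

Definition depends_on (R : realType) n m (h : slice n m -> R)
    (J : {set 'I_n}) : Prop :=
  forall s : {perm 'I_n}, perm_on (~: J) s ->
  forall x y : slice n m, (forall i, val y i = val x (s i)) -> h y = h x.

(* Main.v *)
Require Import Defs.
From mathcomp Require Import all_boot all_order all_fingroup all_algebra.
From mathcomp Require Import zify ring lra.
From mathcomp Require Import reals.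
From mathcomp Require mpoly classical_sets.
Set Implicit Arguments.
Unset Strict Implicit.
Unset Printing Implicit Defensive.
Import Order.TTheory GRing.Theory Num.Theory.
Local Open Scope ring_scope.

(**
The error is in fact linear in [eps], with no loss in [n] once [n] is large.

On the slice, the sum of (1 - transposition) over ordered pairs is triangular
with respect to the degree and acts on the degree-d layer as the scalar
2d(n-d+1); this gives a Poincare inequality and its converse for
degree at most k.  Applying Poincare to g^2 and inducting on the degree (a
difference along a transposition has lower degree, on a smaller slice) bounds
E[g^4] by K (E[g^2])^2, with K depending on k and p only.

Let g be the low-degree part of f and s a permutation of the coordinates.  The
function f - f o s has values in {0, 2, -2} and is close to g - g o s, so by
the fourth moment bound s changes f with probability at most 6 eps or more than
1/(4K).  This gap makes "the transposition (a b) changes f with probability at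
most 6 eps" an equivalence relation, and every permutation preserving its
classes again changes f with probability at most 6 eps.  The bound on the total
influence of g shows that all but O(kK) coordinates lie in one class, so a
majority vote over the permutations of that class is a junta h close to f.

Finally, the (k+1)-fold differences of h along disjoint transpositions are
integers determined by boundedly many coordinates and are small on average, so
they vanish identically; for a harmonic polynomial this forces degree at most k.
*)

(** * Orthogonal projection in finite-dimensional function spaces *)

Section Projection.
Variables (R : realFieldType) (X I : finType) (P : {set X}).
Implicit Types u v w : X -> R.

Definition dot u v : R := \sum_(x in P) u x * v x.

Lemma dotC u v : dot u v = dot v u.
Proof. by apply: eq_bigr => x _; rewrite mulrC. Qed.

Lemma eq_dot u u' v v' :
  {in P, u =1 u'} -> {in P, v =1 v'} -> dot u v = dot u' v'.
Proof. by move=> eu ev; apply: eq_bigr => x Px; rewrite eu ?ev. Qed.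

Lemma dotDl u u' v : dot (fun x => u x + u' x) v = dot u v + dot u' v.
Proof. by rewrite -big_split /=; apply: eq_bigr => x _; rewrite mulrDl. Qed.

Lemma dotZl t u v : dot (fun x => t * u x) v = t * dot u v.
Proof. by rewrite mulr_sumr; apply: eq_bigr => x _; rewrite mulrA. Qed.

Lemma dotBl u u' v : dot (fun x => u x - u' x) v = dot u v - dot u' v.
Proof. by rewrite -sumrB; apply: eq_bigr => x _; rewrite mulrBl. Qed.

Lemma dotDr u v v' : dot u (fun x => v x + v' x) = dot u v + dot u v'.
Proof. by rewrite dotC dotDl !(dotC u). Qed.

Lemma dotBr u v v' : dot u (fun x => v x - v' x) = dot u v - dot u v'.
Proof. by rewrite dotC dotBl !(dotC u). Qed.

Lemma dotZr t u v : dot u (fun x => t * v x) = t * dot u v.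
Proof. by rewrite dotC dotZl dotC. Qed.

Lemma dot_sumr (J : Type) (r : seq J) (Q : pred J) (F : J -> X -> R) u :
  dot u (fun x => \sum_(j <- r | Q j) F j x) = \sum_(j <- r | Q j) dot u (F j).
Proof.
by rewrite exchange_big /=; apply: eq_bigr => x _; rewrite mulr_sumr.
Qed.

Lemma dot_ge0 u : 0 <= dot u u.
Proof. by apply: sumr_ge0 => x _; rewrite -expr2 sqr_ge0. Qed.

Lemma dot_eq0 u : dot u u = 0 -> {in P, forall x, u x = 0}.
Proof.
move=> u0 x Px; move/eqP: u0; rewrite psumr_eq0; last first.
  by move=> y _; rewrite -expr2 sqr_ge0.
by move=> /allP /(_ x); rewrite mem_index_enum Px mulf_eq0 orbb => /(_ isT)/eqP.
Qed.

Lemma orth_proj (v : I -> X -> R) (r : seq I) u :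
  exists2 c : I -> R, (forall j, j \notin r -> c j = 0)
    & {in r, forall i, dot (fun x => u x - \sum_j c j * v j x) (v i) = 0}.
Proof.
elim: r u => [|i r IHr] u.
  by exists (fun=> 0).
have [cu cu0 cuP] := IHr u; have [cv cv0 cvP] := IHr (v i).
pose u' x := u x - \sum_j cu j * v j x.
pose v' x := v i x - \sum_j cv j * v j x.
have orth w : {in r, forall j, dot w (v j) = 0} ->
    dot w v' = dot w (v i).
  move=> w0; rewrite dotBr dot_sumr big1 ?subr0 // => j _.
  rewrite dotZr; have [/w0->|/cv0->] := boolP (j \in r); by rewrite ?mulr0 ?mul0r.
(* Gram-Schmidt coefficient along the residual [v'] of [v i]. If [v'] has norm zero, it vanishes on
   [P], so [tP] survives the division by zero. *)
pose t := dot u' v' / dot v' v'.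
have tP : dot u' v' = t * dot v' v'.
  have [v0|v0] := eqVneq (dot v' v') 0; last by rewrite divfK.
  rewrite v0 mulr0; apply: big1 => x Px.
  by rewrite (dot_eq0 v0 Px) mulr0.
exists (fun j => cu j + t * ((j == i)%:R - cv j)) => [j|].
  rewrite inE negb_or => /andP[/negbTE-> jr].
  by rewrite cu0 ?cv0 // subr0 mulr0 addr0.
have uE x : u x - \sum_j (cu j + t * ((j == i)%:R - cv j)) * v j x
    = u' x - t * v' x.
  have diE : \sum_j (j == i)%:R * v j x = v i x.
    by rewrite (bigD1 i) //= eqxx mul1r big1 ?addr0 // => j /negbTE->; rewrite mul0r.
  rewrite /u' /v' -diE -sumrB mulr_sumr -addrA -opprD -big_split /=.
  by congr (_ - _); apply: eq_bigr => j _; ring.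
move=> j; rewrite (@eq_dot _ (fun x => u' x - t * v' x) _ (v j)) //.
rewrite dotBl dotZl inE; case/predU1P => [->|jr]; last by rewrite cuP ?cvP ?mulr0 ?subr0.
by rewrite -(orth u') // -(orth v') // -tP subrr.
Qed.

End Projection.

(** * The spectrum of the transposition Laplacian on the slice *)

Section Level.
Variables (R : realFieldType) (T : finType).
Implicit Types (W A B S : {set T}) (c : {set T} -> R) (g h : {set T} -> R).

(** The slice over a variable ground set [W], so that inductions can delete two coordinates and stay
    in the same family. *)
Definition level W (m : nat) := [set A : {set T} | (A \subset W) && (#|A| == m)].

Lemma card_level W m : #|level W m| = 'C(#|W|, m).
Proof. exact: cards_draws. Qed.

(** The multilinear polynomial with coefficients [c] at the indicator vector of [A]. *)
Definition pol c A : R := \sum_(S : {set T} | S \subset A) c S.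

Definition deg_le W k c :=
  forall S, ~~ ((S \subset W) && (#|S| <= k)%N) -> c S = 0.

Lemma polE c A : pol c A = \sum_(S : {set T}) c S * (S \subset A)%:R.
Proof.
rewrite /pol big_mkcond; apply: eq_bigr => S _.
by case: ifP; rewrite ?mulr1 ?mulr0.
Qed.

Lemma polB c c' A : pol (fun S => c S - c' S) A = pol c A - pol c' A.
Proof. exact: sumrB. Qed.

Lemma polZ t c A : pol (fun S => t * c S) A = t * pol c A.
Proof. by rewrite /pol mulr_sumr. Qed.

Lemma deg_leW W k k' c : (k <= k')%N -> deg_le W k c -> deg_le W k' c.
Proof.
move=> kk' ck S Sk'; apply: ck; apply: contra Sk' => /andP[-> /=].
by move=> /leq_trans; apply.
Qed.

Lemma deg_leB W k c c' :
  deg_le W k c -> deg_le W k c' -> deg_le W k (fun S => c S - c' S).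
Proof. by move=> ck ck' S Sk; rewrite ck ?ck' ?subr0. Qed.

Definition swap (a b : T) A : {set T} := tperm a b @: A.

Lemma mem_perm_imset (s : {perm T}) A x : (s x \in s @: A) = (x \in A).
Proof. exact: mem_imset perm_inj. Qed.

Lemma mem_swap a b A x : (x \in swap a b A) = (tperm a b x \in A).
Proof. by rewrite -{1}[x](tpermK a b) mem_perm_imset. Qed.

Lemma swapK a b : involutive (swap a b).
Proof. by move=> A; apply/setP => x; rewrite !mem_swap tpermK. Qed.

Lemma swapC a b A : swap a b A = swap b a A.
Proof. by rewrite /swap tpermC. Qed.

Lemma swap_id a b A : (a \in A) = (b \in A) -> swap a b A = A.
Proof.
move=> ab; apply/setP => x; rewrite mem_swap.
by case: tpermP => // ->.
Qed.

Lemma swapE a b A : a \in A -> b \notin A -> swap a b A = b |: (A :\ a).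
Proof.
move=> aA bA; apply/setP => x; rewrite mem_swap !inE.
have ab : a != b by apply: contraNneq bA => <-.
case: tpermP => [->|->|]; rewrite ?eqxx ?(negbTE ab) ?(negbTE bA) ?aA //=.
by move=> /eqP/negbTE-> /eqP/negbTE->.
Qed.

Lemma subset_swap a b S A : (S \subset swap a b A) = (swap a b S \subset A).
Proof.
apply/subsetP/subsetP => H x.
  by rewrite mem_swap => /H; rewrite mem_swap tpermK.
by rewrite mem_swap => xS; apply: H; rewrite mem_swap tpermK.
Qed.

Lemma swap_level W m a b A : a \in W -> b \in W ->
  (swap a b A \in level W m) = (A \in level W m).
Proof.
move=> aW bW; rewrite !inE card_imset; last exact: perm_inj.
congr (_ && _); rewrite -{2}[W](_ : swap a b W = W) ?subset_swap //.
by apply: swap_id; rewrite aW bW.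
Qed.

Lemma sum_swap W m a b (F : {set T} -> R) : a \in W -> b \in W ->
  \sum_(A in level W m) F (swap a b A) = \sum_(A in level W m) F A.
Proof.
move=> aW bW; rewrite [RHS](reindex_inj (inv_inj (@swapK a b))).
by apply: eq_bigl => A; rewrite swap_level.
Qed.

Definition lap W g A : R := \sum_(a in W) \sum_(b in W) (g A - g (swap a b A)).

Lemma dot_lap W m g h : dot (level W m) (lap W g) h =
  \sum_(a in W) \sum_(b in W)
    (dot (level W m) g h - dot (level W m) (fun A => g (swap a b A)) h).
Proof.
under [LHS]eq_bigr do rewrite mulr_suml.
rewrite exchange_big; apply: eq_bigr => a aW.
under [LHS]eq_bigr do rewrite mulr_suml.
by rewrite exchange_big; apply: eq_bigr => b bW; rewrite -dotBl.
Qed.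

Lemma dot_swap W m a b g h : a \in W -> b \in W ->
  dot (level W m) (fun A => g (swap a b A)) h =
  dot (level W m) g (fun A => h (swap a b A)).
Proof.
move=> aW bW; rewrite /dot -(sum_swap m _ aW bW).
by apply: eq_bigr => A _; rewrite swapK.
Qed.

Lemma lap_sym W m g h :
  dot (level W m) (lap W g) h = dot (level W m) g (lap W h).
Proof.
rewrite [RHS]dotC !dot_lap; apply: eq_bigr => a aW; apply: eq_bigr => b bW.
by rewrite dot_swap // [in LHS](dotC _ g h) [in LHS](dotC _ g).
Qed.

Lemma dot_lapE W m g : 2 * dot (level W m) (lap W g) g =
  \sum_(a in W) \sum_(b in W)
    \sum_(A in level W m) (g A - g (swap a b A)) ^+ 2.
Proof.
rewrite dot_lap mulr_sumr; apply: eq_bigr => a aW.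
rewrite mulr_sumr; apply: eq_bigr => b bW.
transitivity (\sum_(A in level W m) (g A ^+ 2 + g (swap a b A) ^+ 2
   - 2 * (g (swap a b A) * g A))).
  rewrite sumrB big_split /= -mulr_sumr (sum_swap m (fun A => g A ^+ 2)) //.
  rewrite mulrBr /dot; congr (_ - _).
  by rewrite mulrDl mul1r; congr (_ + _); apply: eq_bigr => A _; rewrite expr2.
by apply: eq_bigr => A _; ring.
Qed.

Lemma eq_lap W m g h : {in level W m, g =1 h} ->
  {in level W m, lap W g =1 lap W h}.
Proof.
move=> gh A Am; apply: eq_bigr => a aW; apply: eq_bigr => b bW.
by rewrite !gh ?swap_level.
Qed.

Lemma sum_setU1 (F : {set T} -> T -> R) :
  \sum_(S : {set T}) \sum_(a in S) F S a =
  \sum_(S : {set T}) \sum_(a | a \notin S) F (a |: S) a.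
Proof.
rewrite (exchange_big_dep xpredT) // [RHS](exchange_big_dep xpredT) //=.
apply: eq_bigr => a _.
rewrite (reindex_onto (fun S => a |: S) (fun S => S :\ a)) /=; last first.
  by move=> S aS; rewrite setD1K.
apply: eq_bigl => S; rewrite setU11 /=.
case: (boolP (a \in S)) => [aS|/setU1K->]; last by rewrite eqxx.
by apply/negbTE/eqP => E; move: aS; rewrite -E !inE eqxx.
Qed.

(** Only transpositions exchanging some [a] in [S] with some [b] outside move the monomial of [S].
    For fixed [a], the moved monomial is 1 at [A] when [A] contains [S :\ a] and [b], so summing
    over [b] counts [A :\: S]. *)
Lemma lap_mono W m S A : S \subset W -> A \in level W m ->
  lap W (fun B => (S \subset B)%:R) A =
  2 * (#|S|%:R * (#|W|%:R - #|S|%:R + 1) * (S \subset A)%:R)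
  - 2 * ((m%:R - #|S|%:R + 1) * \sum_(a in S) (S :\ a \subset A)%:R).
Proof.
move=> SW; rewrite inE => /andP[AW /eqP <-]; rewrite /lap.
pose t a b : R := (S \subset A)%:R - (S \subset swap a b A)%:R.
have tC a b : t a b = t b a by rewrite /t swapC.
have t0 a b : (a \in S) = (b \in S) -> t a b = 0.
  by move=> ab; rewrite /t subset_swap swap_id ?subrr.
transitivity (2 * \sum_(a in S) \sum_(b in W :\: S) t a b).
  rewrite (big_setID S) /= (setIidPr SW) mulrDl mul1r; congr (_ + _).
    apply: eq_bigr => a aS; rewrite (big_setID S) /= (setIidPr SW).
    rewrite big1 ?add0r // => b bS; exact: t0 (etrans aS (esym bS)).
  rewrite exchange_big /= [LHS](big_setID S) /= (setIidPr SW) addrC big1.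
    rewrite add0r; apply: eq_bigr => a aS; apply: eq_bigr => b _; exact: tC.
  move=> a; rewrite inE => /andP[aS _]; apply: big1 => b.
  by rewrite inE => /andP[bS _]; apply: t0; rewrite (negbTE aS) (negbTE bS).
rewrite -mulrBr; congr (2 * _).
have SE a : a \in S -> \sum_(b in W :\: S) t a b =
    (#|W|%:R - #|S|%:R + 1) * (S \subset A)%:R
    - (#|A|%:R - #|S|%:R + 1) * (S :\ a \subset A)%:R.
  move=> aS.
  transitivity ((#|W|%:R - #|S|%:R) * (S \subset A)%:R
    - (S :\ a \subset A)%:R * #|A :\: S|%:R :> R).
    rewrite sumrB sumr_const cardsDS // -[X in X - _]mulr_natl natrB ?subset_leq_card //.
    congr (_ - _).
    rewrite -sum1_card natr_sum mulr_sumr [RHS]big_mkcond /= [LHS]big_mkcond /=.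
    apply: eq_bigr => b _; rewrite !inE subset_swap.
    have [bS|bS] //= := boolP (b \in S).
    rewrite swapE // subUset sub1set.
    have [bA|bA] := boolP (b \in A); first by rewrite (subsetP AW) ?mulr1.
    by rewrite andbC /= andbF; case: ifP.
  have [SaA|SaA] := boolP (S :\ a \subset A); last first.
    rewrite (_ : S \subset A = false) ?mulr0 ?mul0r ?subrr //.
    by apply: contraNF SaA; apply: subset_trans; apply: subD1set.
  have -> : #|A :\: S|%:R = #|A|%:R - #|S|%:R + 1 - (S \subset A)%:R :> R.
    rewrite -(cardsID S A) natrD (cardsD1 a S) aS.
    have -> : A :&: S = (if a \in A then a |: (S :\ a) else S :\ a).
      apply/setP => x; rewrite inE.
      case: ifP => aA; rewrite !inE; have [->|xa] /= := eqVneq x a; rewrite ?aA ?aS //.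
      + by case xS: (x \in S); rewrite ?andbF // (subsetP SaA) // !inE xa.
      + by case xS: (x \in S); rewrite ?andbF // (subsetP SaA) // !inE xa.
    have -> : (S \subset A) = (a \in A).
      rewrite -{1}(setD1K aS) subUset sub1set SaA andbT //.
    case: ifP => _; last by rewrite natrD /= subr0; ring.
    by rewrite cardsU1 !inE eqxx !natrD /=; ring.
  by rewrite mul1r mulr1; ring.
rewrite (eq_bigr _ SE) sumrB sumr_const -mulr_sumr.
by rewrite -[X in X - _ = _]mulr_natl mulrA.
Qed.

(** The Laplacian on coefficients. It is triangular: the value at [S] involves only [S] and its
    one-element extensions. *)
Definition lapc W m c S : R :=
  2 * (#|S|%:R * (#|W|%:R - #|S|%:R + 1)) * c S
  - 2 * (m%:R - #|S|%:R) * \sum_(a | a \notin S) c (a |: S).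

Lemma lap_pol W m k c A : deg_le W k c -> A \in level W m ->
  lap W (pol c) A = pol (lapc W m c) A.
Proof.
move=> ck Am.
transitivity (\sum_(S : {set T}) c S * lap W (fun B => (S \subset B)%:R) A).
  rewrite /lap; under [RHS]eq_bigr do rewrite mulr_sumr.
  rewrite [RHS]exchange_big; apply: eq_bigr => a _.
  under [RHS]eq_bigr do rewrite mulr_sumr.
  rewrite [RHS]exchange_big; apply: eq_bigr => b _.
  by rewrite !polE -sumrB; apply: eq_bigr => S _; rewrite mulrBr.
transitivity (\sum_(S : {set T})
  (2 * (#|S|%:R * (#|W|%:R - #|S|%:R + 1)) * c S * (S \subset A)%:R
   - \sum_(a in S) 2 * (m%:R - #|S|%:R + 1) * c S * (S :\ a \subset A)%:R)).
  apply: eq_bigr => S _.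
  have [SW|SW] := boolP (S \subset W); last first.
    by rewrite ck ?(negbTE SW) // big1 => [|a _]; rewrite !(mulr0, mul0r) ?subr0.
  by rewrite (lap_mono SW Am) -mulr_sumr; ring.
rewrite sumrB sum_setU1 polE -sumrB; apply: eq_bigr => S _.
rewrite [RHS]mulrBl; congr (_ - _).
rewrite mulr_sumr mulr_suml; apply: eq_bigr => a aS.
by rewrite setU1K // cardsU1 aS add1n -natr1; ring.
Qed.

Lemma lapc_deg W m k c : deg_le W k c -> deg_le W k (lapc W m c).
Proof.
move=> ck S Sk; rewrite /lapc ck // mulr0 sub0r big1 ?mulr0 ?oppr0 // => a aS.
apply: ck; apply: contra Sk; rewrite subUset cardsU1 aS => /andP[/andP[_ ->]] /=.
exact: ltnW.
Qed.

(** A set of size [k.+1] has no extension in the support of [c], so only the diagonal term of [lapc]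
    survives there. *)
Lemma lapc_top W m k c : deg_le W k.+1 c ->
  deg_le W k (fun S => lapc W m c S - 2 * (k.+1%:R * (#|W|%:R - k%:R)) * c S).
Proof.
move=> ck S Sk.
have [Sk1|Sk1] := boolP ((S \subset W) && (#|S| <= k.+1)%N); last first.
  by rewrite (lapc_deg m ck) // ck // mulr0 subrr.
have SE : #|S| = k.+1.
  move: Sk1 Sk => /andP[-> S1] /=; rewrite -ltnNge => S2.
  by apply/eqP; rewrite eqn_leq S1.
rewrite /lapc SE big1 => [|a aS]; first by rewrite -natr1; ring.
by apply: ck; rewrite cardsU1 aS SE ltnn andbF.
Qed.

Lemma proj_deg W m k (g : {set T} -> R) :
  exists2 c, deg_le W k c
    & forall c', deg_le W k c' -> dot (level W m) (fun A => g A - pol c A) (pol c') = 0.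
Proof.
pose r := enum [pred S : {set T} | (S \subset W) && (#|S| <= k)%N].
have rP S : (S \in r) = (S \subset W) && (#|S| <= k)%N.
  by rewrite mem_enum.
have [c c0 cP] := orth_proj (level W m) (fun S B => (S \subset B)%:R) r g.
exists c => [S Sk|c' c'k]; first by apply: c0; rewrite rP.
transitivity (\sum_(S : {set T}) c' S * dot (level W m) (fun A => g A - pol c A)
    (fun B => (S \subset B)%:R)).
  rewrite -(eq_bigr _ (fun S _ => dotZr _ _ _ _)) -dot_sumr.
  by apply: eq_dot => A _ //; rewrite polE.
apply: big1 => S _; have [/cP Sr|Sr] := boolP (S \in r); last first.
  by rewrite c'k ?mul0r // -rP.
rewrite (_ : dot _ _ _ = 0) ?mulr0 // -[RHS]Sr.
by apply: eq_dot => A _ //; rewrite polE.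
Qed.

(* Splitting off the part orthogonal to lower degrees diagonalises [lap]. *)
Lemma lap_spectral W m k c : deg_le W k c ->
  dot (level W m) (lap W (pol c)) (pol c)
     <= 2 * (k * #|W|)%:R * dot (level W m) (pol c) (pol c) /\
  ((k <= #|W|)%N ->
   2 * #|W|%:R * (dot (level W m) (pol c) (pol c)
     - (\sum_(A in level W m) pol c A) ^+ 2 / #|level W m|%:R)
   <= dot (level W m) (lap W (pol c)) (pol c)).
Proof.
elim: k c => [|k IHk] c ck.
  have cE A : pol c A = c set0.
    rewrite /pol (bigD1 set0) ?sub0set //= big1 ?addr0 // => S /andP[_ S0].
    by apply: ck; rewrite leqn0 cards_eq0 (negbTE S0) andbF.
  have -> : dot (level W m) (lap W (pol c)) (pol c) = 0.
    apply: big1 => A _; rewrite /lap big1 ?mul0r // => a _.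
    by rewrite big1 // => b _; rewrite !cE subrr.
  split=> [|_]; first by rewrite !mulr_ge0 ?dot_ge0.
  have -> : dot (level W m) (pol c) (pol c) = #|level W m|%:R * c set0 ^+ 2.
    by rewrite mulr_natl -sumr_const; apply: eq_bigr => A _; rewrite cE.
  rewrite (eq_bigr _ (fun A _ => cE A)) sumr_const -mulr_natl.
  rewrite (_ : _ - _ = 0) ?mulr0 //.
  have [->|N0] := eqVneq (#|level W m|%:R : R) 0; last by field.
  by rewrite invr0 mulr0 mul0r subrr.
set P := level W m.
have [c1 c1k c1P] := proj_deg W m k (pol c).
pose c2 S := c S - c1 S.
have c2k : deg_le W k.+1 c2 by apply: deg_leB => //; apply: deg_leW c1k.
have o2 c' : deg_le W k c' -> dot P (pol c2) (pol c') = 0.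
  move=> /c1P <-; apply: eq_dot => A _ //; exact: polB.
have cE A : pol c A = pol c1 A + pol c2 A by rewrite polB addrC subrK.
pose lam : R := 2 * (k.+1%:R * (#|W|%:R - k%:R)).
have L2 : dot P (lap W (pol c2)) (pol c2) = lam * dot P (pol c2) (pol c2).
  (* By [lapc_top], [c3] has degree at most [k], hence is orthogonal to [c2]. *)
  pose c3 S := lapc W m c2 S - lam * c2 S.
  have := o2 c3 (lapc_top m c2k); rewrite dotC => o3.
  rewrite -[RHS]addr0 -o3 -dotZl -dotDl; apply: eq_dot => A AP //.
  by rewrite (lap_pol c2k AP) (polB _ (fun S => lam * c2 S)) polZ addrC subrK.
have L21 : dot P (lap W (pol c2)) (pol c1) = 0.
  rewrite lap_sym -(o2 (lapc W m c1)); last exact: lapc_deg.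
  by apply: eq_dot => A AP //; rewrite (lap_pol c1k AP).
have LE : dot P (lap W (pol c)) (pol c) =
   dot P (lap W (pol c1)) (pol c1) + lam * dot P (pol c2) (pol c2).
  have lE A : lap W (pol c) A = lap W (pol c1) A + lap W (pol c2) A.
    rewrite /lap -big_split; apply: eq_bigr => a _ /=.
    by rewrite -big_split; apply: eq_bigr => b _ /=; rewrite !cE; ring.
  rewrite (@eq_dot _ _ _ _ (fun A => lap W (pol c1) A + lap W (pol c2) A)
    (pol c) (fun A => pol c1 A + pol c2 A)) //.
  have L12 : dot P (lap W (pol c1)) (pol c2) = 0 by rewrite lap_sym dotC.
  by rewrite dotDl !dotDr L21 L12 L2 add0r addr0.
have DE : dot P (pol c) (pol c) = dot P (pol c1) (pol c1) + dot P (pol c2) (pol c2).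
  rewrite (@eq_dot _ _ _ _ (fun A => pol c1 A + pol c2 A)
    (pol c) (fun A => pol c1 A + pol c2 A)) //.
  by rewrite dotDl !dotDr [dot P (pol c1) (pol c2)]dotC o2 // addr0 add0r.
have [IH1 IH2] := IHk c1 c1k; rewrite LE DE.
have d1 := dot_ge0 P (pol c1); have d2 := dot_ge0 P (pol c2).
have w0 : 0 <= #|W|%:R :> R by []. have k0 : 0 <= k%:R :> R by [].
split=> [|kW].
  rewrite mulrDr; apply: lerD.
    apply: le_trans IH1 _; apply: ler_wpM2r => //; apply: ler_wpM2l => //.
    by rewrite ler_nat leq_mul2r leqnSn orbT.
  apply: ler_wpM2r => //; rewrite natrM; apply: ler_wpM2l => //.
  by apply: ler_wpM2l => //; rewrite gerBl.
have s2 : \sum_(A in P) pol c2 A = 0.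
  pose c0 S : R := (S == set0)%:R.
  have c0E A : pol c0 A = 1.
    rewrite /pol (bigD1 set0) ?sub0set //= /c0 eqxx big1 ?addr0 //.
    by move=> S /andP[_ /negbTE->].
  transitivity (dot P (pol c2) (pol c0)).
    by apply: eq_bigr => A _; rewrite c0E mulr1.
  apply: o2 => S; rewrite /c0; have [->|//] := eqVneq S set0.
  by rewrite sub0set cards0.
have -> : \sum_(A in P) pol c A = \sum_(A in P) pol c1 A.
  by rewrite (eq_bigr _ (fun A _ => cE A)) big_split /= s2 addr0.
rewrite addrAC mulrDr; apply: lerD; first exact: IH2 (ltnW kW).
apply: ler_wpM2r => //; apply: ler_wpM2l => //.
(* Since (k+1)(w-k) = w + k(w-k-1), no degree from 1 to w has an eigenvalue below that of degree
   one. *)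
have : k.+1%:R <= #|W|%:R :> R by rewrite ler_nat.
rewrite -natr1; set w := #|W|%:R; nra.
Qed.

End Level.

(** * The Poincare inequality and restriction to smaller slices *)

Section CauchySchwarz.
Variables (R : realFieldType) (X : finType) (P : {set X}).

Lemma dot_CS (u v : X -> R) : dot P u v ^+ 2 <= dot P u u * dot P v v.
Proof.
have uu := dot_ge0 P u; have [u0|u0] := eqVneq (dot P u u) 0.
  rewrite u0 mul0r /dot big1 ?expr0n // => x Px.
  by rewrite (dot_eq0 u0 Px) mul0r.
have := dot_ge0 P (fun x => dot P u u * v x - dot P u v * u x).
rewrite !dotBl !dotBr !dotZl !dotZr [dot P v u]dotC.
have {u0}uu : 0 < dot P u u by rewrite lt_neqAle eq_sym u0.
move=> H; rewrite -subr_ge0 -(pmulr_rge0 _ uu).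
by apply: le_trans H _; rewrite le_eqVlt; apply/orP; left; apply/eqP; ring.
Qed.

End CauchySchwarz.

Section Poincare.
Variables (R : realFieldType) (T : finType).
Implicit Types (W A B S : {set T}) (c g : {set T} -> R).

Definition mean W m g : R := (\sum_(A in level W m) g A) / #|level W m|%:R.

Lemma card_level_gt0 W m : (m <= #|W|)%N -> 0 < #|level W m|%:R :> R.
Proof. by move=> mW; rewrite ltr0n card_level bin_gt0. Qed.

Lemma mean_ge0 W m g : (forall A, 0 <= g A) -> 0 <= mean W m g.
Proof. by move=> g0; rewrite divr_ge0 ?sumr_ge0. Qed.

Lemma sum_mean W m g : (m <= #|W|)%N ->
  \sum_(A in level W m) g A = #|level W m|%:R * mean W m g.
Proof. by move=> /card_level_gt0 N0; rewrite mulrC divfK ?gt_eqF. Qed.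

(** Between sets of the same size, inclusion is equality, so the values of [g] serve as coefficients
    of the size-[m] monomials. The spectral bound thus reaches arbitrary functions. *)
Lemma pol_onto W m g :
  exists2 c, deg_le W m c & {in level W m, pol c =1 g}.
Proof.
exists (fun S => if S \in level W m then g S else 0) => [S|A Am].
  by rewrite inE; case: ifP => // /andP[-> /eqP->]; rewrite leqnn.
rewrite /pol (bigD1 A) //= Am big1 ?addr0 // => S /andP[SA SnA].
case: ifP => //; move: Am; rewrite !inE => /andP[_ /eqP Am] /andP[_ /eqP Sm].
by case/negP: SnA; rewrite eqEcard SA Am Sm leqnn.
Qed.

Lemma poincare W m g : (m <= #|W|)%N ->
  4 * #|W|%:R * (\sum_(A in level W m) g A ^+ 2
     - (\sum_(A in level W m) g A) ^+ 2 / #|level W m|%:R)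
  <= \sum_(a in W) \sum_(b in W)
       \sum_(A in level W m) (g A - g (swap a b A)) ^+ 2.
Proof.
move=> mW; have [c cm cg] := pol_onto W m g.
have [_ /(_ mW) H] := lap_spectral m cm.
rewrite -dot_lapE (@eq_dot _ _ _ _ (lap W (pol c)) _ (pol c)); last 2 first.
- by move=> A Am; rewrite (eq_lap cg Am).
- by move=> A Am; rewrite cg.
have E (x y : R) : 4 * x * y = 2 * (2 * x * y) by ring.
rewrite E ler_pM2l //; move: H.
by rewrite (eq_bigr _ cg) (@eq_dot _ _ _ (pol c) g _ g).
Qed.

(** Where [F] is nonzero, [A] contains exactly one of [a], [b]; deleting it moves the sum to a
    smaller slice. *)
Lemma sum_level_split W m a b (F : {set T} -> R) :
    a \in W -> b \in W -> a != b ->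
    (forall A, (a \in A) = (b \in A) -> F A = 0) ->
  \sum_(A in level W m.+1) F A =
  \sum_(A in level (W :\ a :\ b) m) (F (a |: A) + F (b |: A)).
Proof.
have half x y (xW : x \in W) (xy : x != y) :
    \sum_(A in level W m.+1 | (x \in A) && (y \notin A)) F A =
    \sum_(A in level (W :\ x :\ y) m) F (x |: A).
  rewrite (reindex_onto (fun A => x |: A) (fun A => A :\ x)) /=; last first.
    by move=> A /andP[_ /andP[xA _]]; rewrite setD1K.
  apply: eq_bigl => A; rewrite !inE eqxx /= [y == x]eq_sym (negbTE xy) /=.
  have [xA|xA] := boolP (x \in A).
    have -> : ((x |: A) :\ x == A) = false.
      by apply/negbTE/eqP => E; move: xA; rewrite -E !inE eqxx.
    rewrite andbF; apply/esym/negbTE; rewrite negb_and; apply/orP; left.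
    by apply/subsetPn; exists x => //; rewrite !inE eqxx andbF.
  rewrite setU1K // eqxx andbT cardsU1 xA add1n eqSS subUset sub1set xW /=.
  rewrite -andbA [(_ == _) && _]andbC andbA; congr (_ && _).
  by rewrite !subsetD1 xA andbT.
move=> aW bW ab F0; rewrite big_split /= -half //.
rewrite [W :\ a :\ b](_ : _ = W :\ b :\ a); last by rewrite setDDl setUC -setDDl.
rewrite -half ?(eq_sym b) // (bigID (fun A => (a \in A) && (b \notin A))) /=.
congr (_ + _); rewrite big_mkcondr [RHS]big_mkcondr /=.
apply: eq_bigr => A _; case aA: (a \in A); case bA: (b \in A) => //=;
  by rewrite F0 // aA bA.
Qed.

Lemma swapU1 a b A : a \notin A -> b \notin A -> swap a b (a |: A) = b |: A.
Proof.
move=> aA bA; have [->|ab] := eqVneq a b; first by rewrite swap_id.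
rewrite swapE ?setU11 ?setU1K // !inE negb_or bA andbT eq_sym //.
Qed.

Lemma notin_level2 W m a b A : A \in level (W :\ a :\ b) m ->
  (a \notin A) && (b \notin A).
Proof.
rewrite inE !subsetD1 => /andP[/andP[/andP[_ ->] ->]] //.
Qed.

(** Coefficients of the derivative in [a] minus the derivative in [b], with both variables set to
    0. *)
Definition diffc a b c S : R :=
  if (a \in S) || (b \in S) then 0 else c (a |: S) - c (b |: S).

Lemma pol_diff a b c A : a \notin A -> b \notin A ->
  pol c (a |: A) - pol c (b |: A) = pol (diffc a b c) A.
Proof.
have half x : x \notin A -> pol c (x |: A) =
    pol c A + \sum_(S : {set T} | S \subset A) c (x |: S).
  move=> xA; rewrite /pol (bigID (fun S => x \in S)) /= addrC; congr (_ + _).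
    apply: eq_bigl => S; have [xS|xS] := boolP (x \in S); rewrite ?andbT ?andbF.
      by apply/esym/negbTE; apply: contra xA => /subsetP; apply.
    rewrite -{2}(setU1K xA) subsetD1 xS andbT //.
  rewrite (reindex_onto (fun S => x |: S) (fun S => S :\ x)) /=; last first.
    by move=> S /andP[_ xS]; rewrite setD1K.
  apply: eq_bigl => S; rewrite setU11 andbT.
  have [xS|xS] := boolP (x \in S).
    have -> : (x |: S) :\ x == S = false.
      by apply/negbTE/eqP => E; move: xS; rewrite -E !inE eqxx.
    by rewrite andbF; apply/esym/negbTE; apply: contra xA => /subsetP; apply.
  rewrite setU1K // eqxx andbT subUset sub1set setU11 /=.
  by rewrite -{2}(setU1K xA) subsetD1 xS andbT.
move=> aA bA; rewrite !half // opprD addrACA subrr add0r -sumrB.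
apply: eq_bigr => S SA; rewrite /diffc.
by rewrite !(contraNF (subsetP SA _)) .
Qed.

Lemma diffc_deg W k a b c : a != b -> deg_le W k.+1 c ->
  deg_le (W :\ a :\ b) k (diffc a b c).
Proof.
move=> ab ck S Sk; rewrite /diffc; case: ifP => // /norP[aS bS].
suff E x : x \notin S -> c (x |: S) = 0 by rewrite !E ?subrr.
move=> xS; apply: ck; apply: contra Sk.
rewrite cardsU1 xS subUset !subsetD1 aS bS !andbT => /andP[/andP[_ ->]].
by rewrite add1n ltnS.
Qed.

End Poincare.

(** * Fourth moments of low-degree functions *)

Section Hypercontractivity.
Variables (R : rcfType) (T : finType).
Implicit Types (W A B S : {set T}) (c g : {set T} -> R).

(** [al] is a lower bound on the density of the slice, halved whenever two coordinates are deleted.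
    The square comes from the quadratic inequality ending [fourth_moment]. *)
Fixpoint hyper_const (k : nat) (al : R) : R :=
  if k is k'.+1 then (1 + 4 * k%:R * (hyper_const k' (al / 2) / al)) ^+ 2 else 1.

Lemma hyper_const_ge1 k al : 0 < al -> 1 <= hyper_const k al.
Proof.
elim: k al => [|k IHk] al al0 //=.
have /IHk K1 : 0 < al / 2 by rewrite divr_gt0.
rewrite exprn_ege1 // lerDl !mulr_ge0 ?invr_ge0 ?(ltW al0) //.
exact: le_trans K1.
Qed.

Lemma card_setD2 W a b : a \in W -> b \in W -> a != b -> #|W :\ a :\ b| = #|W|.-2.
Proof.
move=> aW bW ab; have := cardsD1 b (W :\ a); have := cardsD1 a W.
by rewrite aW !inE eq_sym ab bW /= => -> ->; rewrite !add1n.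
Qed.

(** With w = |W|, the quotient of the sizes is (m+1)(w-m-1) / (w(w-1)); here m+1 is at least [al] w,
    and w-m-1 at least half of w-1. *)
Lemma level_ratio W m a b (al : R) : 0 <= al -> a \in W -> b \in W -> a != b ->
  (2 * m.+1 <= #|W|)%N -> al * #|W|%:R <= m.+1%:R ->
  al * #|level W m.+1|%:R <= 2 * #|level (W :\ a :\ b) m|%:R.
Proof.
move=> al0 aW bW ab mW alm; rewrite !card_level.
rewrite card_setD2 //.
have w2 : (1 < #|W|)%N by apply: leq_trans mW; rewrite mulnS; case: (m).
move: #|W| w2 mW alm => [|[|w]] // _ mW alm /=.
have e1 := mul_bin_diag w.+2 m; have e2 := mul_bin_down w.+1 m.
rewrite /= in e1 e2; rewrite -(ler_pM2l (_ : 0 < (w.+2 * w.+1)%:R)) ?ltr0n //.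
have -> : (w.+2 * w.+1)%:R * (2 * 'C(w, m)%:R) =
   2 * ((w.+1 - m) * m.+1)%:R * 'C(w.+2, m.+1)%:R :> R.
  rewrite -[2]/(2%:R) -!natrM; congr _%:R.
  rewrite mulnCA -mulnA e2 [(w.+2 * _)%N]mulnCA e1 !mulnA; ring.
rewrite mulrA; apply: ler_wpM2r => //; rewrite !natrM.
rewrite mulrAC [w.+2%:R * _]mulrC.
rewrite [leRHS](_ : _ = m.+1%:R * (2 * (w.+1 - m)%:R)); last by ring.
apply: ler_pM => //; first by rewrite mulr_ge0.
by rewrite -[2]/(2%:R) -natrM ler_nat; lia.
Qed.

(** Poincare for g^2 bounds X - Y^2, with X and Y the fourth and second moments, by the energy of
    g^2. Each difference of g^2 factors as (g - g')(g + g'). Cauchy-Schwarz leaves the fourth moment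
    of g - g', known by induction on the degree, and that of g + g', at most 16 X. The converse
    Poincare inequality then sums the second moments of g - g'. The case [m == 0] ends the induction
    on a one-point slice. *)
Lemma fourth_moment k (al : R) W m c : 0 < al <= 1 -> (2 * m <= #|W|)%N ->
    (m == 0)%N || (al * #|W|%:R <= m%:R) -> deg_le W k c ->
  mean W m (fun A => pol c A ^+ 4) <=
  hyper_const k al * mean W m (fun A => pol c A ^+ 2) ^+ 2.
Proof.
elim: k al W m c => [|k IHk] al W m c /andP[al0 al1] mW alm ck.
  have cE A : pol c A = c set0.
    rewrite /pol (bigD1 set0) ?sub0set //= big1 ?addr0 // => S /andP[_ S0].
    by apply: ck; rewrite leqn0 cards_eq0 (negbTE S0) andbF.
  have N0 : 0 < #|level W m|%:R :> R.
    by apply: card_level_gt0; apply: leq_trans mW; rewrite leq_pmull.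
  rewrite /= mul1r /mean.
  under eq_bigr do rewrite cE. under [in leRHS]eq_bigr do rewrite cE.
  rewrite !sumr_const -[X in X / _]mulr_natl -[X in _ <= (X / _) ^+ _]mulr_natl.
  by rewrite !(mulrC #|_|%:R) !mulfK ?gt_eqF // -exprM.
have [K1 K2] : 1 <= hyper_const k.+1 al /\ 1 <= hyper_const k (al / 2).
  by split; apply: hyper_const_ge1; rewrite ?divr_gt0.
case: m mW alm => [|m] mW alm.
  have lE : level W 0 = [set set0].
    by apply/setP => A; rewrite !inE cards_eq0 andb_idl // => /eqP->; rewrite sub0set.
  rewrite /mean lE !big_set1 cards1 !divr1 -exprM ler_peMl //.
  by rewrite exprn_even_ge0.
rewrite /= in alm; set P := level W m.+1; set N : R := #|P|%:R.
have mW' : (m.+1 <= #|W|)%N by apply: leq_trans mW; rewrite leq_pmull.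
have N0 : 0 < N by apply: card_level_gt0.
pose g := pol c; set X := mean _ _ _; pose Y := mean W m.+1 (fun A => g A ^+ 2).
have X0 : 0 <= X by apply: mean_ge0 => A; rewrite exprn_even_ge0.
have Y0 : 0 <= Y by apply: mean_ge0 => A; rewrite sqr_ge0.
pose s := Num.sqrt X; have s0 : 0 <= s := sqrtr_ge0 _.
have sX : s ^+ 2 = X by rewrite sqr_sqrtr.
pose K := hyper_const k (al / 2) / al.
have K1' : 1 <= K.
  by rewrite ler_pdivlMr // mul1r; apply: le_trans al1 K2.
have K0 : 0 <= K := le_trans ler01 K1'.
have step a b : a \in W -> b \in W ->
    \sum_(A in P) (g A ^+ 2 - g (swap a b A) ^+ 2) ^+ 2 <=
    4 * K * s * \sum_(A in P) (g A - g (swap a b A)) ^+ 2.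
  move=> aW bW; have [<-|ab] := eqVneq a b.
    rewrite !big1 ?mulr0 // => A _; by rewrite swap_id // subrr expr0n.
  set I := (X in _ <= _ * X).
  have I0 : 0 <= I by apply: sumr_ge0 => A _; rewrite sqr_ge0.
  pose W' := W :\ a :\ b; pose N' : R := #|level W' m|%:R.
  have mW'' : (2 * m <= #|W'|)%N by rewrite card_setD2 //; clear -mW; lia.
  have N'0 : 0 < N'.
    by apply: card_level_gt0; apply: leq_trans mW''; rewrite leq_pmull.
  pose D := \sum_(A in P) (g A - g (swap a b A)) ^+ 4.
  (* The powers are even, so sets containing [a] and sets containing [b] contribute equally. *)
  have split_pow p : \sum_(A in P) (g A - g (swap a b A)) ^+ (2 * p.+1) =
      2 * (N' * mean W' m (fun A => pol (diffc a b c) A ^+ (2 * p.+1))).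
    rewrite -sum_mean; last by apply: leq_trans mW''; rewrite leq_pmull.
    rewrite (sum_level_split m aW bW ab) => [|A abA]; last first.
      by rewrite swap_id // subrr expr0n.
    rewrite mulr_sumr; apply: eq_bigr => A /notin_level2 /andP[aA bA].
    rewrite swapU1 // swapC swapU1 // -(pol_diff c aA bA) -/g.
    by rewrite !exprM -(sqrrN (g (b |: A) - _)) opprB mulr2n mulrDl mul1r.
  have DE := split_pow 1; have IE := split_pow 0; rewrite -/I -/D in DE IE.
  have DI : D * N <= hyper_const k (al / 2) / al * I ^+ 2.
    set M4 := mean _ _ _ in DE; set M2 := mean _ _ _ in IE.
    have M0 : 0 <= M2 by apply: mean_ge0 => A; rewrite sqr_ge0.
    have IH : M4 <= hyper_const k (al / 2) * M2 ^+ 2.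
      apply: IHk mW'' _ (diffc_deg ab ck); first by apply/andP; split; lra.
      (* From al |W| <= m' + 2 follows (al / 2) |W| <= m' + 1: halving the density absorbs the lost
         element. *)
      case: (m) alm => //= m' alm; rewrite card_setD2 //.
      have w2 : #|W|.-2%:R <= #|W|%:R :> R by rewrite ler_nat -subn2 leq_subr.
      apply: le_trans (ler_wpM2l _ w2) _; first by rewrite divr_ge0 // ltW.
      by rewrite mulrAC ler_pdivrMr // (le_trans alm) // -natrM ler_nat; clear; lia.
    have NN : N <= 2 * N' / al.
      by rewrite ler_pdivlMr // mulrC; apply: level_ratio => //; apply: ltW.
    rewrite DE IE.
    apply: (@le_trans _ _
      (2 * (N' * (hyper_const k (al / 2) * M2 ^+ 2)) * (2 * N' / al))).
      apply: ler_pM => //; first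
        by rewrite -DE; apply: sumr_ge0 => A _; rewrite exprn_even_ge0.
      by rewrite !ler_pM2l.
    by rewrite le_eqVlt; apply/orP; left; apply/eqP; ring.
  have SE : \sum_(A in P) (g A + g (swap a b A)) ^+ 4 <= 16 * N * s ^+ 2.
    apply: le_trans (_ : \sum_(A in P) 8 * (g A ^+ 4 + g (swap a b A) ^+ 4) <= _).
      apply: ler_sum => A _; move: (g A) (g (swap a b A)) => x y.
            rewrite -subr_ge0 [leRHS](_ : _ = 4 * (x ^+ 2 - y ^+ 2) ^+ 2
        + (x - y) ^+ 2 * (2 * (x ^+ 2 + y ^+ 2) + (x + y) ^+ 2)); last by ring.
      by rewrite !(sqr_ge0, addr_ge0, mulr_ge0).
    rewrite -mulr_sumr big_split /= (sum_swap m.+1 (fun A => g A ^+ 4)) //.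
    rewrite sX -(mulrA 16) -sum_mean // /g.
    by rewrite le_eqVlt; apply/orP; left; apply/eqP; ring.
  have L0 : 0 <= \sum_(A in P) (g A ^+ 2 - g (swap a b A) ^+ 2) ^+ 2.
    by apply: sumr_ge0 => A _; rewrite sqr_ge0.
  have R0 : 0 <= 4 * K * s * I by do 3!apply: mulr_ge0 => //.
  rewrite -(@ler_pXn2r _ 2) ?nnegrE //.
  rewrite (_ : \sum_(A in P) _ = dot P (fun A => (g A - g (swap a b A)) ^+ 2)
     (fun A => (g A + g (swap a b A)) ^+ 2)); last first.
    by apply: eq_bigr => A _; ring.
  apply: le_trans (dot_CS _ _ _) _.
  have -> : dot P (fun A => (g A - g (swap a b A)) ^+ 2)
     (fun A => (g A - g (swap a b A)) ^+ 2) = D by apply: eq_bigr => A _; ring.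
  rewrite (_ : dot _ _ _ = \sum_(A in P) (g A + g (swap a b A)) ^+ 4); last first.
    by apply: eq_bigr => A _; ring.
  have D0 : 0 <= D by apply: sumr_ge0 => A _; rewrite exprn_even_ge0.
  apply: le_trans (ler_wpM2l D0 SE) _.
  apply: le_trans (_ : 16 * s ^+ 2 * (K * I ^+ 2) <= _).
    rewrite [leLHS](_ : _ = 16 * s ^+ 2 * (D * N)); last by ring.
    by rewrite ler_wpM2l // mulr_ge0 // sqr_ge0.
  (* As [K] is at least 1, K <= K^2, which matches the squared target. *)
  rewrite [leRHS](_ : _ = 16 * s ^+ 2 * (K * K * I ^+ 2)); last by ring.
  rewrite ler_wpM2l ?mulr_ge0 ?sqr_ge0 // ler_wpM2r ?sqr_ge0 //.
  by rewrite ler_peMr.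
have w0 : 0 < #|W|%:R :> R by rewrite ltr0n; apply: leq_ltn_trans mW'.
have XY : X - Y ^+ 2 <= 4 * k.+1%:R * K * s * Y.
  have := poincare (fun A => g A ^+ 2) mW'; rewrite -/P -/N.
  rewrite [X in _ * (_ - X ^+ 2 / _)](sum_mean _ mW') -/Y -/N.
  rewrite (eq_bigr (fun A => g A ^+ 4)) => [|A _]; last by rewrite -exprM.
  rewrite [X in _ * (X - _)](sum_mean _ mW') -/X -/N => H.
  have : 4 * #|W|%:R * (N * (X - Y ^+ 2)) <=
      4 * K * s * (2 * (2 * (k.+1 * #|W|)%:R * (N * Y))).
    rewrite (_ : N * (X - Y ^+ 2) = N * X - (N * Y) ^+ 2 / N); last first.
      by field; rewrite gt_eqF.
    apply: le_trans H _.
    apply: le_trans (_ : 4 * K * s * (2 * dot P (lap W g) g) <= _).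
      rewrite dot_lapE mulr_sumr; apply: ler_sum => a aW.
      by rewrite mulr_sumr; apply: ler_sum => b bW; apply: step.
    have Ks : 0 <= 4 * K * s by do 2!apply: mulr_ge0 => //.
    apply: ler_wpM2l => //; apply: ler_wpM2l => //.
    have [H1 _] := lap_spectral m.+1 ck; apply: le_trans H1 _.
    by rewrite /N -sum_mean.
  have N4 : 0 < 4 * #|W|%:R * N by rewrite !mulr_gt0.
  move=> H2; rewrite -(ler_pM2l N4).
  rewrite [leLHS](_ : _ = 4 * #|W|%:R * (N * (X - Y ^+ 2))); last by ring.
  apply: le_trans H2 _.
  by rewrite natrM le_eqVlt; apply/orP; left; apply/eqP; ring.
pose be := 4 * k.+1%:R * K.
have be0 : 0 <= be by do 2!apply: mulr_ge0 => //.
have -> : hyper_const k.+1 al = (1 + be) ^+ 2 by [].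
rewrite -/Y -sX -exprMn ler_pXn2r ?nnegrE //; last first.
  by apply: mulr_ge0 => //; apply: addr_ge0.
(* Otherwise s (s - (1 + be) Y) + (s - Y) Y, which equals s^2 - Y^2 - be s Y, would be positive,
   against [XY]. *)
rewrite leNgt; apply/negP => lt.
have beY : 0 <= be * Y by apply: mulr_ge0.
have Ys : Y <= s by lra.
have s1 : 0 < s by lra.
have h1 : 0 < s * (s - (1 + be) * Y) by rewrite mulr_gt0 // subr_gt0.
have h2 : 0 <= (s - Y) * Y by rewrite mulr_ge0 // subr_ge0.
by move: XY; rewrite -sX -/be; nra.
Qed.

End Hypercontractivity.

(** * The influence gap and the majority vote *)

Section MeanTheory.
Variables (R : realFieldType) (T : finType).
Implicit Types (W A B S : {set T}) (u v : {set T} -> R).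

Lemma meanD W m u v : mean W m (fun A => u A + v A) = mean W m u + mean W m v.
Proof. by rewrite /mean big_split mulrDl. Qed.

Lemma meanZ W m t u : mean W m (fun A => t * u A) = t * mean W m u.
Proof. by rewrite /mean -mulr_sumr mulrA. Qed.

Lemma le_mean W m u v : {in level W m, forall A, u A <= v A} ->
  mean W m u <= mean W m v.
Proof. by move=> uv; rewrite ler_wpM2r ?invr_ge0 // ler_sum. Qed.

Lemma eq_mean W m u v : {in level W m, u =1 v} -> mean W m u = mean W m v.
Proof. by move=> uv; rewrite /mean (eq_bigr _ uv). Qed.

Lemma mean_CS W m u v : mean W m (fun A => u A * v A) ^+ 2
  <= mean W m (fun A => u A ^+ 2) * mean W m (fun A => v A ^+ 2).
Proof.
rewrite /mean mulrACA -expr2 exprMn; apply: ler_wpM2r; first exact: sqr_ge0.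
exact: dot_CS.
Qed.

Lemma mean_cst W m (t : R) : (m <= #|W|)%N -> mean W m (fun=> t) = t.
Proof.
move=> /(card_level_gt0 R) N0.
by rewrite /mean sumr_const -[X in X / _]mulr_natl mulrC mulrA mulVf ?mul1r ?gt_eqF.
Qed.

Lemma mean_sum (I : finType) (Q : pred I) W m (F : I -> {set T} -> R) :
  mean W m (fun A => \sum_(i | Q i) F i A) = \sum_(i | Q i) mean W m (F i).
Proof. by rewrite /mean exchange_big mulr_suml. Qed.

End MeanTheory.

Section Gap.
Variables (R : rcfType) (T : finType) (m k : nat) (al eps : R).
Variables (f : {set T} -> R) (c : {set T} -> R).
Implicit Types (A B S : {set T}) (s t : {perm T}) (a b : T).
Hypothesis al01 : 0 < al <= 1.
Hypothesis m_half : (2 * m <= #|T|)%N.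
Hypothesis m_al : al * #|T|%:R <= m%:R.
Hypothesis c_deg : deg_le [set: T] k c.

Local Notation P := (level [set: T] m).
Local Notation E := (mean [set: T] m).
Local Notation g := (pol c).
Local Notation K := (hyper_const k al).

Hypothesis f_sign : {in P, forall A, f A = 1 \/ f A = -1}.
Hypothesis f_near : E (fun A => (f A - g A) ^+ 2) <= eps.

Let mT : (m <= #|[set: T]|)%N.
Proof. by rewrite cardsT; apply: leq_trans m_half; rewrite leq_pmull. Qed.

Let K1 : 1 <= K.
Proof. by apply: hyper_const_ge1; case/andP: al01. Qed.

Let K0 : 0 < K. Proof. exact: lt_le_trans ltr01 K1. Qed.

Let eps0 : 0 <= eps.
Proof. by apply: le_trans f_near; apply: mean_ge0 => A; apply: sqr_ge0. Qed.

Lemma perm_level s A : (s @: A \in P) = (A \in P).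
Proof. by rewrite !inE !subsetT card_imset //; apply: perm_inj. Qed.

Lemma perm_imsetM s t A : (s * t)%g @: A = t @: (s @: A).
Proof. by rewrite -imset_comp; apply: eq_imset => x; rewrite permM. Qed.

Lemma perm_imset1 A : (1%g : {perm T}) @: A = A.
Proof. by rewrite (eq_imset _ (@perm1 T)) imset_id. Qed.

Lemma mean_perm s (u : {set T} -> R) : E (fun A => u (s @: A)) = E u.
Proof.
congr (_ / _); rewrite [RHS](reindex_inj (imset_inj (@perm_inj _ s))).
by apply: eq_bigl => A; rewrite perm_level.
Qed.

Lemma pol_perm s A : pol c (s @: A) = pol (fun S => c (s @: S)) A.
Proof.
rewrite /pol (reindex_inj (imset_inj (@perm_inj _ s))).
apply: eq_bigl => S; apply/subsetP/subsetP => H x xS.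
  by have := H (s x); rewrite !mem_perm_imset => ->.
by move: xS => /imsetP[y yS ->]; rewrite mem_perm_imset H.
Qed.

(** Acts as a length on the symmetric group: zero at the identity and subadditive, because
    permutations preserve the uniform measure. *)
Definition dis s : R := E (fun A => (f A != f (s @: A))%:R).

Lemma dis_ge0 s : 0 <= dis s.
Proof. exact: mean_ge0. Qed.

Lemma disM s t : dis (s * t)%g <= dis s + dis t.
Proof.
rewrite -[dis t](mean_perm s) -meanD; apply: le_mean => A _.
rewrite perm_imsetM -natrD ler_nat; have [->|_] := eqVneq (f A) (f (s @: A)) => //.
by case: (_ != _).
Qed.

Lemma dis1 : dis 1%g = 0.
Proof.
rewrite /dis (@eq_mean _ _ _ _ _ (fun=> 0)) ?mean_cst // => A _.
by rewrite perm_imset1 eqxx.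
Qed.

Let D s A := f A - f (s @: A).
Let G s A := g A - g (s @: A).

Lemma sqrD_le (x y : R) : (x + y) ^+ 2 <= 2 * x ^+ 2 + 2 * y ^+ 2.
Proof. by have := sqr_ge0 (x - y); nra. Qed.

Lemma mean_diff s : E (fun A => (G s A - D s A) ^+ 2) <= 4 * eps.
Proof.
have -> : 4 * eps = 2 * eps + 2 * eps by ring.
apply: (@le_trans _ _ (2 * E (fun A => (f A - g A) ^+ 2)
   + 2 * E (fun A => (f (s @: A) - g (s @: A)) ^+ 2))).
  rewrite -!meanZ -meanD; apply: le_mean => A _.
  rewrite /G /D (_ : _ - _ = (g A - f A) + (f (s @: A) - g (s @: A))); last by ring.
  by apply: le_trans (sqrD_le _ _) _; rewrite -(sqrrN (g A - f A)) opprB.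
by rewrite (mean_perm s (fun A => (f A - g A) ^+ 2)) lerD // ler_pM2l.
Qed.

Lemma mean_D s : E (fun A => D s A ^+ 2) = 4 * dis s.
Proof.
rewrite -meanZ; apply: eq_mean => A AP; rewrite /D.
have sAP : s @: A \in P by rewrite perm_level.
have n1 : (1 != -1 :> R) by apply/eqP; lra.
case: (f_sign AP) (f_sign sAP) => -> [] ->; rewrite ?eqxx /=.
- by ring.
- by rewrite n1 mulr1; ring.
- by rewrite eq_sym n1 mulr1; ring.
- by ring.
Qed.

Lemma mean_D_le s : 4 * dis s <= 2 * E (fun A => G s A ^+ 2) + 8 * eps.
Proof.
rewrite -mean_D; apply: (@le_trans _ _ (2 * E (fun A => G s A ^+ 2)
  + 2 * E (fun A => (G s A - D s A) ^+ 2))).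
  rewrite -!meanZ -meanD; apply: le_mean => A _.
  have := sqrD_le (G s A) (D s A - G s A); rewrite addrC subrK.
  by rewrite (sqrrB (D s A)) (sqrrB (G s A)); nra.
by have := mean_diff s; lra.
Qed.

(* Hypercontractivity: a nearly low-degree function cannot have small support,
   so a permutation moves [f] either almost nowhere or on a constant fraction. *)
Lemma gap s : 4 * K * dis s <= 1 -> dis s <= 6 * eps.
Proof.
move=> small; set Y := E (fun A => G s A ^+ 2).
have Y0 : 0 <= Y by apply: mean_ge0 => A; apply: sqr_ge0.
have GE : G s =1 pol (fun S => c S - c (s @: S)).
  by move=> A; rewrite (polB _ (fun S => c (s @: S))) -pol_perm.
have Gdeg : deg_le [set: T] k (fun S => c S - c (s @: S)).
  apply: deg_leB => // S Sk; apply: c_deg; apply: contra Sk.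
  by rewrite !subsetT card_imset //; apply: perm_inj.
have X4 : E (fun A => G s A ^+ 4) <= K * Y ^+ 2.
  have := fourth_moment al01 _ _ Gdeg.
  rewrite cardsT => /(_ m m_half); rewrite m_al orbT => /(_ isT).
  have GpE p : E (fun A => pol (fun S => c S - c (s @: S)) A ^+ p) =
      E (fun A => G s A ^+ p) by apply: eq_mean => A _; rewrite GE.
  by rewrite !GpE.
(* The energy of [G s] where [s] changes [f]. Elsewhere [D s] vanishes, so [G s] is pure
   approximation error. *)
pose Z := E (fun A => G s A ^+ 2 * (f A != f (s @: A))%:R).
have Z0 : 0 <= Z by apply: mean_ge0 => A; rewrite mulr_ge0 ?sqr_ge0.
have YZ : Y <= Z + 4 * eps.
  apply: le_trans (lerD (lexx Z) (mean_diff s)).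
  rewrite -meanD; apply: le_mean => A _; rewrite /D.
  have [->|_] := eqVneq (f A) _; first by rewrite mulr0 subrr subr0 add0r.
  by rewrite mulr1 lerDl sqr_ge0.
have ZY : Z ^+ 2 <= K * Y ^+ 2 * dis s.
  pose v A : R := (f A != f (s @: A))%:R.
  have e1 : E (fun A => (G s A ^+ 2) ^+ 2) = E (fun A => G s A ^+ 4).
    by apply: eq_mean => A _; rewrite -exprM.
  have e2 : E (fun A => v A ^+ 2) = dis s.
    by apply: eq_mean => A _; rewrite /v; case: (_ != _); rewrite ?expr1n ?expr0n.
  have := mean_CS [set: T] m (fun A => G s A ^+ 2) v; rewrite e1 e2 => H.
  by apply: le_trans H _; apply: ler_wpM2r => //; apply: dis_ge0.
have Z2 : 2 * Z <= Y.
  have Z20 : 0 <= 2 * Z by apply: mulr_ge0.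
  rewrite -(@ler_pXn2r _ 2) ?nnegrE //.
  apply: le_trans (_ : 4 * (K * Y ^+ 2 * dis s) <= _).
    by rewrite exprMn -[2 ^+ 2]/(2 * 2) -natrM ler_pM2l.
  rewrite [leLHS](_ : _ = Y ^+ 2 * (4 * K * dis s)); last by ring.
  by rewrite ler_piMr ?sqr_ge0.
(* Y <= Y / 2 + 4 eps gives Y <= 8 eps, then 4 dis s <= 16 eps + 8 eps. *)
move: (mean_D_le s) YZ Z2; rewrite -/Y; lra.
Qed.

Hypothesis eps_small : 72 * K * eps <= 1.

(** Three factors of 6 eps each give 18 eps, which [eps_small] keeps below the threshold of [gap];
    the bound resets to 6 eps and errors never accumulate. *)
Lemma gap_close s : dis s <= 18 * eps -> dis s <= 6 * eps.
Proof.
move=> H; apply: gap; apply: le_trans eps_small.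
rewrite [leRHS](_ : _ = 4 * K * (18 * eps)); last by ring.
by apply: ler_wpM2l => //; rewrite mulr_ge0 // ltW.
Qed.

Definition twin a b := dis (tperm a b) <= 6 * eps.

Lemma twin_refl a : twin a a.
Proof. by rewrite /twin tperm1 dis1 mulr_ge0. Qed.

Lemma twin_sym a b : twin a b = twin b a.
Proof. by rewrite /twin tpermC. Qed.

(** [tperm a d] is the conjugate of [tperm b d] by [tperm a b], a product of three factors to which
    [gap_close] applies. *)
Lemma twin_trans a b d : twin a b -> twin b d -> twin a d.
Proof.
move=> ab bd; have [->|nab] := eqVneq a b => //.
have [<-|nbd] := eqVneq b d => //.
have [->|nad] := eqVneq a d; first exact: twin_refl.
apply: gap_close.
have -> : tperm a d = (tperm a b * (tperm b d * tperm a b))%g.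
  rewrite -{1}[tperm a b]tpermV -/(conjg _ _) tpermJ tpermR.
  by rewrite tpermD // eq_sym.
apply: le_trans (disM _ _) _; have := disM (tperm b d) (tperm a b).
by move: ab bd; rewrite /twin; lra.
Qed.

Variable a0 : T.

(** Minimising the number of non-twins makes [core] the complement of a largest twin class. *)
Definition center := [arg min_(a < a0) #|[set b | ~~ twin a b]|].
Definition core := [set b | ~~ twin center b].

Lemma core_twin a b : a \notin core -> b \notin core -> twin a b.
Proof.
rewrite !inE !negbK => ca cb; apply: twin_trans cb.
by rewrite twin_sym.
Qed.

(** By [gap], each non-twin pair contributes at least 1/(4K) to the total influence of g, which the
    converse Poincare inequality and E g^2 <= 4 bound by 16 k |T|. By minimality, |core| is at most
    the average number of non-twins. *)
Lemma card_core : #|core|%:R <= 64 * k%:R * K.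
Proof.
have T0 : 0 < #|T|%:R :> R by rewrite ltr0n; apply/card_gt0P; exists a0.
have coreP a : (#|core| <= #|[set b | ~~ twin a b]|)%N.
  by rewrite /core /center; case: arg_minnP => // i _; apply.
have g2 : E (fun A => g A ^+ 2) <= 4.
  apply: (@le_trans _ _ (2 * E (fun A => f A ^+ 2)
     + 2 * E (fun A => (f A - g A) ^+ 2))).
    rewrite -!meanZ -meanD; apply: le_mean => A _.
    have := sqrD_le (f A) (g A - f A); rewrite addrC subrK.
    by rewrite (sqrrB (g A)) (sqrrB (f A)); nra.
  rewrite (@eq_mean _ _ _ _ _ (fun=> 1)); last first.
    by move=> A /f_sign[]->; rewrite ?sqrrN expr1n.
  rewrite mean_cst // mulr1.
  have : eps <= 1 by move: eps_small K1 eps0; nra.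
  by move: f_near; lra.
have pairE a b : ~~ twin a b -> 1 <= 4 * K * E (fun A => G (tperm a b) A ^+ 2).
  move=> nab; have d4 : 1 < 4 * K * dis (tperm a b).
    by rewrite ltNge; apply: contra nab => /gap.
  (* The error term 8 K eps is at most 1/9, absorbed by passing from 2 K to 4 K. *)
  have := ler_wpM2l (ltW K0) (mean_D_le (tperm a b)).
  by move: eps_small; lra.
have tot : \sum_a \sum_b E (fun A => G (tperm a b) A ^+ 2) <= 16 * k%:R * #|T|%:R.
  have N0 := card_level_gt0 R mT.
  rewrite (_ : \sum_a _ = 2 * dot P (lap [set: T] g) g / #|P|%:R); last first.
    rewrite dot_lapE mulr_suml; apply: eq_big => [a|a _]; first by rewrite inE.
    by rewrite mulr_suml; apply: eq_big => [b|b _]; rewrite ?inE.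
  rewrite ler_pdivrMr //; have [+ _] := lap_spectral m c_deg.
  rewrite cardsT natrM => /(ler_wpM2l (ler0n _ 2)) H; apply: le_trans H _.
  have -> : dot P g g = #|P|%:R * E (fun A => g A ^+ 2).
    by rewrite -sum_mean //; apply: eq_bigr => A _; rewrite expr2.
  rewrite [leLHS](_ : _ = 4 * k%:R * #|T|%:R * #|P|%:R * E (fun A => g A ^+ 2));
    last by ring.
  rewrite [leRHS](_ : _ = 4 * k%:R * #|T|%:R * #|P|%:R * 4); last by ring.
  by rewrite ler_wpM2l // !mulr_ge0.
rewrite -(ler_pM2r T0).
apply: (@le_trans _ _ (4 * K * \sum_a \sum_b E (fun A => G (tperm a b) A ^+ 2))).
  rewrite mulr_natr -sumr_const mulr_sumr; apply: ler_sum => a _.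
  apply: (@le_trans _ _ #|[set b | ~~ twin a b]|%:R); first by rewrite ler_nat.
  rewrite -sum1_card natr_sum big_mkcond mulr_sumr; apply: ler_sum => b _.
  rewrite inE; case: ifP => [/pairE //|_].
  apply: mulr_ge0; first by rewrite mulr_ge0 // ltW.
  by apply: mean_ge0 => A; apply: sqr_ge0.
rewrite [leRHS](_ : _ = 4 * K * (16 * k%:R * #|T|%:R)); last by ring.
by rewrite ler_wpM2l // mulr_ge0 // ltW.
Qed.

(** Induction on the number of moved points: composing [s] with [tperm x (s x)] fixes [x], and
    [gap_close] brings the resulting 12 eps back to 6 eps. *)
Lemma dis_core s : perm_on (~: core) s -> dis s <= 6 * eps.
Proof.
elim: {s}#|[set x | s x != x]| {-2}s (leqnn #|[set x | s x != x]|) => [|N IH] s.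
  rewrite leqn0 cards_eq0 => /eqP s1 _; rewrite (_ : s = 1%g).
    by rewrite dis1 mulr_ge0.
  apply/permP => x; rewrite perm1; apply/eqP; rewrite -[_ == _]negbK.
  by have := in_set0 x; rewrite -s1 inE => ->.
move=> sN son; have [s1|[x sx]] := set_0Vmem [set x | s x != x].
  by apply: IH => //; rewrite s1 cards0.
rewrite inE in sx.
have xc : x \notin core by have := subsetP son x; rewrite !inE; apply.
have sxc : s x \notin core.
  by have := subsetP son (s x); rewrite !inE (inj_eq perm_inj); apply.
pose t := (s * tperm x (s x))%g.
have ton : perm_on (~: core) t.
  apply: perm_onM => //; apply/subsetP => y; rewrite !inE.
  case: tpermP => [->|->|]; rewrite ?eqxx //.
  - by move: xc; rewrite !inE.
  - by move: sxc; rewrite !inE.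
have tN : (#|[set y | t y != y]| <= N)%N.
  rewrite -ltnS; apply: leq_trans sN; apply: proper_card; apply/properP; split.
    apply/subsetP => y; rewrite !inE permM.
    case: tpermP => [sy _|/perm_inj->|] //; rewrite ?eqxx //.
    by rewrite sy; apply: contraNneq sx => xy; rewrite {1}xy sy.
  by exists x; rewrite ?inE // permM tpermR eqxx.
have -> : s = (t * tperm x (s x))%g by rewrite -mulgA tperm2 mulg1.
apply: gap_close; apply: le_trans (disM _ _) _.
have := IH t tN ton; have := core_twin xc sxc; have := eps0.
by rewrite /twin; lra.
Qed.

Definition vote A : R :=
  if 0 <= \sum_(s | perm_on (~: core) s) f (s @: A) then 1 else -1.

Lemma vote_sign A : vote A = 1 \/ vote A = -1.
Proof. by rewrite /vote; case: ifP; [left|right]. Qed.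

Lemma vote_swap a b A : a \notin core -> b \notin core ->
  vote (swap a b A) = vote A.
Proof.
move=> ac bc; rewrite /vote; congr (if 0 <= _ then _ else _).
have ton : perm_on (~: core) (tperm a b).
  apply/subsetP => y; rewrite !inE.
  by case: tpermP => [->|->|]; rewrite ?eqxx //; move: ac bc; rewrite !inE.
rewrite [RHS](reindex_inj (mulgI (tperm a b))).
apply: eq_big => s; last by rewrite perm_imsetM.
apply/idP/idP => [|H]; first exact: perm_onM.
by rewrite -[s](mulKg (tperm a b)) tpermV perm_onM.
Qed.

(** Exchanging an element of [A :\: B] with one of [B :\: A], both outside [core], keeps the vote
    and brings [A] closer to [B]. *)
Lemma vote_junta A B : A \in P -> B \in P -> A :&: core = B :&: core ->
  vote A = vote B.
Proof.
elim: {A}#|A :\: B| {-2}A (leqnn #|A :\: B|) => [|N IH] A.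
  rewrite leqn0 cards_eq0 setD_eq0 => AB; rewrite !inE => /andP[_ /eqP cA].
  by move=> /andP[_ /eqP cB] _; congr vote; apply/eqP; rewrite eqEcard AB cA cB /=.
move=> ABN AP BP AB; have [AB0|[a]] := set_0Vmem (A :\: B).
  by apply: IH; rewrite // AB0 cards0.
rewrite inE => /andP[aB aA].
have cAB : #|A| = #|B| by move: AP BP; rewrite !inE => /andP[_ /eqP->] /andP[_ /eqP->].
have [BA0|[b]] := set_0Vmem (B :\: A).
  have /eqP BA : B == A by rewrite eqEcard -setD_eq0 BA0 eqxx cAB /=.
  by rewrite BA aA in aB.
rewrite inE => /andP[bA bB].
have inc x : x \in core -> (x \in A) = (x \in B).
  move=> xc; have /setP/(_ x) := AB; rewrite !inE.
  by move: xc; rewrite inE => ->; rewrite !andbT.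
have ac : a \notin core by apply: contra aB => /inc <-.
have bc : b \notin core by apply: contra bA => /inc ->.
rewrite -(@vote_swap a b) //.
have sE : swap a b A = b |: (A :\ a) := swapE aA bA.
apply: IH => //.
- rewrite -ltnS; apply: leq_trans ABN; apply: proper_card; apply/properP; split.
    rewrite sE; apply/subsetP => x; rewrite !in_setD in_setU1 in_setD1.
    by have [->|_] := eqVneq x b; rewrite ?bB //= => /andP[-> /andP[_ ->]].
  exists a; rewrite !in_setD ?aA ?aB // sE in_setU1 in_setD1 eqxx orbF.
  by rewrite /= ; apply: contraNN bA => /eqP <-.
- by rewrite /swap perm_level.
- rewrite -AB; apply/setP => x; rewrite !in_setI sE in_setU1 in_setD1.
  have [->|_] := eqVneq x b; first by rewrite (negbTE bc) !andbF.
  by have [->|_] := eqVneq x a; first by rewrite (negbTE ac) !andbF.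
Qed.

(** If the vote differs from [f] at [A], at least half of the permutations change [f] there, so the
    squared difference is at most 8 times their proportion. Averaging with [dis_core] gives 8 * 6 =
    48. *)
Lemma mean_vote : E (fun A => (f A - vote A) ^+ 2) <= 48 * eps.
Proof.
pose gr := #|[pred s | perm_on (~: core) s]|.
have gr0 : 0 < gr%:R :> R.
  by rewrite ltr0n; apply/card_gt0P; exists 1%g; apply: perm_on1.
rewrite -(ler_pM2l gr0) -meanZ.
apply: (@le_trans _ _ (8 * \sum_(s | perm_on (~: core) s) dis s)).
  rewrite /dis -mean_sum -meanZ; apply: le_mean => A AP.
  rewrite /vote; set S1 := \sum_(s | _) f _; set S2 := \sum_(s | _) _.
  have S2E : f A * S1 = gr%:R - 2 * S2.
    rewrite /gr -sum1_card natr_sum /S1 /S2 !mulr_sumr -sumrB.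
    apply: eq_bigr => s _; have sAP : s @: A \in P by rewrite perm_level.
    have n1 : (1 != -1 :> R) by apply/eqP; lra.
    case: (f_sign AP) (f_sign sAP) => -> [] ->;
      by rewrite ?eqxx ?n1 ?[-1 == _]eq_sym ?n1 /=; ring.
  have S20 : 0 <= S2 by apply: sumr_ge0.
  by case: (f_sign AP) S2E => ->; case: (leP 0 S1) => S1s E1; lra.
apply: le_trans (_ : 8 * \sum_(s | perm_on (~: core) s) 6 * eps <= _).
  by rewrite ler_pM2l // ler_sum // => s; apply: dis_core.
rewrite sumr_const -/gr -mulr_natl.
by rewrite le_eqVlt; apply/orP; left; apply/eqP; ring.
Qed.

End Gap.

(** * Iterated differences and the degree *)

Section Vanish.
Variables (R : realFieldType) (T : finType).
Implicit Types (W A B S J X : {set T}) (c F : {set T} -> R) (a b : T).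

(** All [j]-fold differences along disjoint transpositions vanish; for m < j there are none, whence
    [True]. *)
Fixpoint vanish (j : nat) W (m : nat) F : Prop :=
  match j, m with
  | 0, _ => {in level W m, forall A, F A = 0}
  | _.+1, 0 => True
  | j'.+1, m'.+1 => forall a b, a \in W -> b \in W -> a != b ->
      vanish j' (W :\ a :\ b) m' (fun A => F (a |: A) - F (b |: A))
  end.

(** The sum is the coefficient at [S] of the sum of the partial derivatives. *)
Definition harmonic_on W c :=
  forall S, S \subset W -> \sum_(i in W | i \notin S) c (i |: S) = 0.

Lemma level_setU1 W m a b A : a \in W ->
  A \in level (W :\ a :\ b) m -> a |: A \in level W m.+1.
Proof.
move=> aW Am; have /andP[aA _] := notin_level2 Am.
move: Am; rewrite !inE !subsetD1 -!andbA => /and4P[AW _ _ /eqP Am].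
by rewrite subUset sub1set aW AW cardsU1 aA Am add1n eqxx.
Qed.

Lemma level_setD2C W m a b A :
  A \in level (W :\ a :\ b) m -> A \in level (W :\ b :\ a) m.
Proof. by rewrite setDDl setUC -setDDl. Qed.

Lemma eq_vanish j W m F F' : {in level W m, F =1 F'} ->
  vanish j W m F -> vanish j W m F'.
Proof.
elim: j W m F F' => [|j IHj] W [|m] F F' FF' //= vF.
- by move=> A Am; rewrite -FF' // vF.
- by move=> A Am; rewrite -FF' // vF.
move=> a b aW bW ab; apply: IHj (vF a b aW bW ab) => A Am.
rewrite !FF' //; first exact: level_setU1 bW (level_setD2C Am).
exact: level_setU1 Am.
Qed.

(** Differences stay harmonic, so induction on [m] gives c (a |: S) = c (b |: S) for [a], [b]
    outside a large enough [S]. Harmonicity at [S :\ a] then says that a positive number of copies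
    of [c S] sum to zero. *)
Lemma vanish_harmonic m W j c : (m <= #|W|)%N ->
    deg_le W (minn m (#|W| - m)) c -> harmonic_on W c -> vanish j W m (pol c) ->
  forall S, (j <= #|S|)%N -> c S = 0.
Proof.
elim: m W j c => [|m IHm] W j c mW cd ch vc.
  move=> S; have [->|S0] := eqVneq S set0; last first.
    by rewrite cd // min0n leqn0 cards_eq0 (negbTE S0) andbF.
  rewrite cards0 leqn0 => /eqP j0; move: vc; rewrite j0 /= => /(_ set0).
  rewrite inE sub0set cards0 => /(_ isT) <-.
  rewrite /pol (big_pred1 set0) // => S'; exact: subset0.
have dE S : c S != 0 -> S \subset W /\ (#|S| <= minn m.+1 (#|W| - m.+1))%N.
  by move=> S0; apply/andP; apply: contraNT S0 => /cd->.
have eq_c a b S : a \in W -> b \in W -> a \notin S -> b \notin S ->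
    (j.-1 <= #|S|)%N -> c (a |: S) = c (b |: S).
  move=> aW bW aS bS jS; have [->//|ab] := eqVneq a b.
  have := @IHm (W :\ a :\ b) j.-1 (diffc a b c).
  have cW := card_setD2 aW bW ab.
  have W2 : (1 < #|W|)%N by apply/card_gt1P; exists a, b.
  have [|m_lt] := ltnP (#|W| - 2) m.
    (* Here |W| = m + 1, so the degree bound is 0. *)
    move=> Wm; have c0 x : x \notin S -> c (x |: S) = 0.
      move=> xS; apply/eqP; apply: contraTT isT => /dE[_].
      by rewrite cardsU1 xS leq_min => /andP[_]; clear -Wm mW W2; lia.
    by rewrite !c0.
  rewrite cW -subn2 => /(_ m_lt) H.
  have /H {}H : deg_le (W :\ a :\ b) (minn m (#|W| - 2 - m)) (diffc a b c).
    apply: diffc_deg => // S' S'd; apply: cd; apply: contra S'd => /andP[-> /=].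
    by clear -mW W2 m_lt; lia.
  have /H {}H : harmonic_on (W :\ a :\ b) (diffc a b c).
    move=> S' S'W; have /andP[aS' bS'] : (a \notin S') && (b \notin S').
      by move: S'W; rewrite !subsetD1 => /andP[/andP[_ ->] ->].
    have S'W0 : S' \subset W by move: S'W; rewrite !subsetD1 => /andP[/andP[->]].
    transitivity (\sum_(i in W :\ a :\ b | i \notin S') c (i |: (a |: S'))
       - \sum_(i in W :\ a :\ b | i \notin S') c (i |: (b |: S'))).
      rewrite -sumrB; apply: eq_bigr => i /andP[]; rewrite !inE => /and3P[ib ia _] _.
      rewrite /diffc !inE (negbTE aS') (negbTE bS') !orbF eq_sym (negbTE ia).
      by rewrite eq_sym (negbTE ib) /= !(setUCA [set i]).
    (* Harmonicity at [x |: S'] with the term of [y] isolated. The result is symmetric in [x] and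
       [y], so the two sums cancel. *)
    have half x y (xW : x \in W) (yW : y \in W) (xy : x != y) (xS' : x \notin S')
      (yS' : y \notin S') : \sum_(i in W :\ x :\ y | i \notin S') c (i |: (x |: S'))
        = - c (x |: (y |: S')).
      have := ch (x |: S'); rewrite subUset sub1set xW S'W0 => /(_ isT).
      rewrite (bigD1 y) /=; last by rewrite yW !inE negb_or eq_sym xy.
      move=> /eqP; rewrite addrC addr_eq0 setUCA => /eqP <-; apply: eq_bigl => i.
      rewrite !inE negb_or.
      by case: (i == x); case: (i == y); case: (i \in W); case: (i \in S').
    rewrite half // -[X in _ - X](_ :
        \sum_(i in W :\ b :\ a | i \notin S') c (i |: (b |: S')) = _).
      by rewrite half 1?eq_sym // setUCA subrr.
    by apply: eq_bigl => i; rewrite !inE; case: (i == a); case: (i == b).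
  have vd : vanish j.-1 (W :\ a :\ b) m (fun A => pol c (a |: A) - pol c (b |: A)).
    (* For j = 0 the function itself vanishes, hence so do its differences, and [j.-1] is still
       0. *)
    case: (j) vc => [|j'] /= vc; last exact: vc.
    move=> A Am; rewrite !vc ?subrr //; first exact: level_setU1 bW (level_setD2C Am).
    exact: level_setU1 Am.
  have /H {}H : vanish j.-1 (W :\ a :\ b) m (pol (diffc a b c)).
    apply: eq_vanish vd => A /notin_level2 /andP[aA bA]; exact: pol_diff.
  have := H S jS; rewrite /diffc (negbTE aS) (negbTE bS) /= => /eqP.
  by rewrite subr_eq0 => /eqP.
have c_pos S : (0 < #|S|)%N -> (j <= #|S|)%N -> c S = 0.
  move=> /card_gt0P[a aS] jS; apply/eqP; apply: contraTT isT => /[dup] cS /dE[SW _].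
  have aW := subsetP SW a aS.
  pose S' := S :\ a; have SE : a |: S' = S by apply: setD1K.
  have aS' : a \notin S' by rewrite !inE eqxx.
  have S'W : S' \subset W by apply: subset_trans SW; apply: subD1set.
  have := ch S' S'W; rewrite (eq_bigr (fun=> c S)) => [|i /andP[iW iS']]; last first.
    rewrite -[X in _ = c X]SE; apply: eq_c => //; rewrite (cardsD1 a) aS in jS.
    by clear -jS; rewrite -/S' in jS; lia.
  move/eqP; rewrite sumr_const -mulr_natr mulf_eq0 (negbTE cS) pnatr_eq0 /=.
  rewrite -leqn0 leqNgt => /negP[]; apply/card_gt0P; exists a.
  by rewrite unfold_in aW.
move=> S jS; have [S0|/c_pos->//] := posnP #|S|.
move/eqP: S0 jS; rewrite cards_eq0 => /eqP->; rewrite cards0 leqn0 => /eqP j0.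
have /card_gt0P[A Am] : (0 < #|level W m.+1|)%N by rewrite card_level bin_gt0.
move: vc; rewrite j0 => /(_ A Am) <-.
rewrite /pol (bigD1 set0) ?sub0set //= big1 ?addr0 // => S' /andP[_ S'0].
by apply: c_pos; rewrite ?j0 // card_gt0.
Qed.

(** Adding [X :&: J] to a choice of m - |X :&: J| elements of [W :\: J] gives a set with the same
    trace on [J]. *)
Lemma card_pattern W m J X : X \in level W m ->
  ('C(#|W :\: J|, m - #|X :&: J|) <= #|[set A in level W m | A :&: J == X :&: J]|)%N.
Proof.
rewrite inE => /andP[XW /eqP Xm].
have sm : (#|X :&: J| <= m)%N by rewrite -Xm subset_leq_card // subsetIl.
rewrite -card_level -(@card_in_imset _ _ (fun A => A :|: (X :&: J))).
  apply: subset_leq_card; apply/subsetP => B /imsetP[A].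
  move=> /[!inE]; rewrite subsetD => /andP[/andP[AW AJ] /eqP Am] ->.
  have AJ0 : A :&: J = set0 by apply/eqP; rewrite setI_eq0.
  rewrite subUset AW (subset_trans (subsetIl _ _) XW) /=.
  rewrite setIUl AJ0 set0U -setIA setIid eqxx andbT cardsU.
  by rewrite setICA AJ0 setI0 cards0 subn0 Am subnK.
move=> A B; rewrite !inE !subsetD => /andP[/andP[_ AJ] _] /andP[/andP[_ BJ] _] E.
have cut (C : {set T}) : [disjoint C & J] -> C = (C :|: (X :&: J)) :\: J.
  move=> CJ; rewrite setDUl (setDidPl CJ) [X in _ :|: X](_ : _ = set0) ?setU0 //.
  by apply/eqP; rewrite setD_eq0 subsetIr.
by rewrite (cut A AJ) (cut B BJ) E.
Qed.

(** Lowering both arguments multiplies the binomial by m/n; lowering only the upper one, by (n-m)/n.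
    The slack in the hypotheses keeps these ratios at least [be] during [t] steps of the first kind
    and [u] of the second. *)
Lemma bin_ratio (be : R) t u n m : 0 <= be ->
    be * n%:R + t%:R <= m%:R -> be * n%:R + (m + u)%:R <= n%:R ->
  be ^+ (t + u) * 'C(n, m)%:R <= 'C(n - (t + u), m - t)%:R.
Proof.
move=> be0; elim: t n m => [|t IHt] n m.
  rewrite add0n subn0 addr0; elim: u n => [|u IHu] n bm bn.
    by rewrite expr0 mul1r subn0.
  case: n bm bn => [|n] bm bn.
    by move: bn; rewrite mulr0 add0r ler_nat addnS.
  have n0 : 0 < n.+1%:R :> R by rewrite ltr0n.
  have mn : (m < n.+1)%N.
    rewrite -(ltr_nat R); apply: lt_le_trans bn.
    by rewrite -[ltLHS]add0r ler_ltD ?mulr_ge0 // ltr_nat addnS ltnS leq_addr.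
  rewrite subSS; apply: le_trans (IHu n _ _).
  - rewrite exprSr -mulrA; apply: ler_wpM2l; first exact: exprn_ge0.
    rewrite -(ler_pM2l n0) -natrM (mul_bin_down n.+1 m) natrM mulrA.
    apply: ler_wpM2r => //; rewrite natrB ?(ltnW mn) //.
    by move: bn; rewrite natrD; have := ler0n R u.+1; lra.
  - apply: le_trans bm; apply: ler_wpM2l => //; by rewrite ler_nat.
  - move: bn; rewrite addnS -!(natr1 n) -(natr1 (m + u)) mulrDr; lra.
move=> bm bn; case: n bm bn => [|n] bm bn.
  move: bm bn; rewrite mulr0 !add0r !ler_nat leqn0 addn_eq0.
  by move=> tm /andP[/eqP m0]; rewrite m0 in tm.
case: m bm bn => [|m] bm bn.
  have := ler_wpM2l be0 (ler0n R n.+1); have := ler0n R t.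
  by move: bm; rewrite mulr0 -natr1; lra.
rewrite addSn !subSS; apply: le_trans (IHt n m _ _).
- rewrite exprSr -mulrA; apply: ler_wpM2l; first exact: exprn_ge0.
  have n0 : 0 < n.+1%:R :> R by rewrite ltr0n.
  rewrite -(ler_pM2l n0) -natrM (mul_bin_diag n.+1 m) natrM mulrA.
  apply: ler_wpM2r => //; move: bm; have := ler0n R t.+1; lra.
- move: bm; rewrite -!natr1 mulrDr; lra.
- move: bn; rewrite addSn -!natr1 mulrDr; lra.
Qed.

End Vanish.

(** * Integer-valued juntas close to low-degree polynomials *)

Section NearVanish.
Variables (R : archiRealFieldType) (T : finType).
Implicit Types (W A B S J X : {set T}) (c F : {set T} -> R) (a b : T).

(** After [j] differences the polynomial is gone, while [F] is still integral and determined by the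
    trace on [J]. A nonzero value would repeat on at least [L] sets and cost [L] in squared error,
    but each difference at most doubles that error. *)
Lemma near_vanish j W m F c J (L : R) :
    {in level W m, forall A, F A \is a Num.int} ->
    {in level W m &, forall A B, A :&: J = B :&: J -> F A = F B} ->
    (forall S, (j <= #|S|)%N -> c S = 0) ->
    (forall W' m' X, W' \subset W -> (#|W'| + 2 * j = #|W|)%N -> (m' + j = m)%N ->
      X \in level W' m' ->
      L <= #|[set A in level W' m' | A :&: J == X :&: J]|%:R) ->
    2 ^+ j * \sum_(A in level W m) (F A - pol c A) ^+ 2 < L ->
  vanish j W m F.
Proof.
elim: j W m F c => [|j IHj] W m F c Fint FJ cj HL small.
  move=> /= X Xm; apply/eqP; apply: contraTT small => FX.
  rewrite -leNgt expr0 mul1r.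
  apply: le_trans (HL W m X _ _ _ Xm) _; rewrite ?addn0 //.
  rewrite -sum1_card natr_sum [leLHS]big_mkcond [leRHS]big_mkcond /=.
  apply: ler_sum => A _; rewrite inE; case Am: (A \in level W m) => //=.
  case: ifP => [/eqP AX|_]; last by rewrite sqr_ge0.
  have -> : pol c A = 0 by rewrite /pol big1 // => S _; rewrite cj.
  by rewrite subr0 (FJ A X) // sqr_intr_ge1 // Fint.
case: m Fint FJ HL small => [|m] Fint FJ HL small //= a b aW bW ab.
have W'E := card_setD2 aW bW ab.
have W2 : (1 < #|W|)%N by apply/card_gt1P; exists a, b.
have aL A : A \in level (W :\ a :\ b) m -> a |: A \in level W m.+1.
  exact: level_setU1.
have bL A : A \in level (W :\ a :\ b) m -> b |: A \in level W m.+1.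
  by move=> Am; exact: level_setU1 bW (level_setD2C Am).
apply: (IHj _ _ _ (diffc a b c)).
- by move=> A Am; rewrite rpredB // Fint // ?aL ?bL.
- move=> A B Am Bm ABJ; congr (_ - _); apply: FJ; rewrite ?aL ?bL //;
    by rewrite !setIUl ABJ.
- move=> S jS; rewrite /diffc; case: ifP => // /norP[aS bS].
  by rewrite !cj ?subrr // cardsU1 ?aS ?bS.
- move=> W' m' X W'W W'c m'm; apply: HL.
  + by apply: subset_trans W'W _; rewrite setDDl subsetDl.
  + by clear -W'c W'E W2; rewrite W'E in W'c; lia.
  + by rewrite addnS m'm.
apply: le_lt_trans small; rewrite exprSr -mulrA ler_pM2l ?exprn_gt0 //.
pose e A := (F A - pol c A) ^+ 2.
pose H A := if (a \in A) == (b \in A) then 0 else e A.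
apply: (@le_trans _ _ (2 * \sum_(A in level W m.+1) H A)); last first.
  rewrite ler_pM2l //; apply: ler_sum => A _; rewrite /H.
  by case: ifP => // _; apply: sqr_ge0.
rewrite (sum_level_split m aW bW ab) => [|A abA]; last by rewrite /H abA eqxx.
rewrite mulr_sumr; apply: ler_sum => A Am.
have /andP[aA bA] := notin_level2 Am.
rewrite -pol_diff // /H !inE !eqxx (negbTE aA) (negbTE bA) /= eq_sym (negbTE ab) /=.
rewrite [b == a]eq_sym (negbTE ab) /= /e.
move: (F _) (F _) (pol _ _) (pol _ _) => x y z t.
by have := sqr_ge0 ((x - z) + (y - t)); nra.
Qed.

End NearVanish.

(** * Harmonic representatives *)

Section Harmonize.
Variables (R : realFieldType) (T : finType).
Implicit Types (A S : {set T}) (c : {set T} -> R).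

(* The top layer is projected off the image of the up operator, which the
   slice identifies with functions of lower degree; what remains is harmonic. *)
Lemma harmonize m d c : deg_le [set: T] d c ->
  exists c', [/\ deg_le [set: T] d c', harmonic_on [set: T] c'
    & {in level [set: T] m, pol c =1 pol c'}].
Proof.
elim: d c => [|d IHd] c cd.
  exists c; split=> // S _; rewrite big1 // => i /andP[_ iS].
  by apply: cd; rewrite cardsU1 iS andbF.
pose P := [set S : {set T} | #|S| == d.+1].
(* [v S] is the image under the up operator of the indicator of [S]. *)
pose v S S' : R := \sum_(a in S') (S == S' :\ a)%:R.
have [q q0 qP] := orth_proj P v (enum [pred S : {set T} | #|S| == d]) c.
have vE S : \sum_S' q S' * v S' S = \sum_(a in S) q (S :\ a).
  under eq_bigr do rewrite mulr_sumr.
  rewrite exchange_big; apply: eq_bigr => a _.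
  rewrite (bigD1 (S :\ a)) //= eqxx mulr1 big1 ?addr0 // => S' /negbTE->.
  by rewrite mulr0.
pose H S := c S - \sum_(a in S) q (S :\ a).
pose c1 S := if S \in P then H S else 0.
have c1d : deg_le [set: T] d.+1 c1.
  move=> S; rewrite subsetT /= /c1 inE => Sd; case: ifP => // /eqP SE.
  by rewrite SE leqnn in Sd.
have c1h : harmonic_on [set: T] c1.
  move=> S _; have [Sd|Sd] := eqVneq #|S| d; last first.
    apply: big1 => i /andP[_ iS]; rewrite /c1 inE cardsU1 iS add1n eqSS.
    by rewrite (negbTE Sd).
  (* Orthogonality to [v S] is the harmonic equation at [S]: the down operator is adjoint to the up
     operator. *)
  have := qP S; rewrite mem_enum inE Sd eqxx => /(_ isT) qS.
  apply: etrans qS; rewrite /dot; under [RHS]eq_bigr do rewrite vE mulr_sumr.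
  rewrite [RHS]big_mkcond /=.
  transitivity (\sum_(S' : {set T}) \sum_(a in S')
      (if S' \in P then H S' * (S == S' :\ a)%:R else 0)); last first.
    by apply: eq_bigr => S' _; case: ifP => // _; rewrite big1.
  rewrite sum_setU1 [RHS](bigD1 S) //= [X in _ + X]big1 ?addr0; last first.
    move=> S' S'S; apply: big1 => a aS'; rewrite setU1K // eq_sym (negbTE S'S).
    by rewrite mulr0 if_same.
  apply: eq_big => [a|a aS]; first by rewrite inE.
  by rewrite /c1 setU1K ?eqxx ?mulr1 //; case/andP: aS.
(* On the slice, the monomials extending [S] by one element sum to m - |S| times the monomial of
   [S]; this rewrites the removed part in degree [d]. *)
pose c2 S := (if (#|S| <= d)%N then c S else 0) + (m%:R - #|S|%:R) * q S.
have c2d : deg_le [set: T] d c2.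
  move=> S; rewrite subsetT /= /c2 => Sd; rewrite (negbTE Sd) q0 ?mulr0 ?addr0 //.
  by rewrite mem_enum inE; apply: contra Sd => /eqP->.
have [c3 [c3d c3h c3E]] := IHd c2 c2d.
exists (fun S => c1 S + c3 S); split.
- by move=> S Sd; rewrite c1d // (deg_leW (leqnSn d) c3d) // addr0.
- by move=> S SW; rewrite big_split /= c1h // c3h // addr0.
move=> A Am; rewrite [RHS]big_split /= -/(pol c3 A) -c3E //.
have upE : \sum_(S : {set T} | S \subset A) (m%:R - #|S|%:R) * q S =
    \sum_(S : {set T} | (S \subset A) && (S \in P)) \sum_(a in S) q (S :\ a).
  transitivity (\sum_(S : {set T}) \sum_(a in S)
      (if S \subset A then q (S :\ a) else 0)); last first.
    rewrite [RHS]big_mkcond; apply: eq_bigr => S _; rewrite inE.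
    case SA: (S \subset A) => /=; last by rewrite big1.
    case: ifP => // Sd; apply: big1 => a aS; apply: q0; rewrite mem_enum inE.
    by move: Sd; rewrite (cardsD1 a) aS add1n eqSS => ->.
  rewrite sum_setU1 [LHS]big_mkcond; apply: eq_bigr => S _.
  under [RHS]eq_bigr => a aS do rewrite setU1K // subUset sub1set.
  rewrite -big_mkcondr /=; have [SA|SA] := boolP (S \subset A); last first.
    by rewrite big_pred0 // => a; rewrite andbF andbF.
  rewrite sumr_const -[RHS]mulr_natl; congr (_ * _).
  move: Am; rewrite inE => /andP[_ /eqP <-].
  rewrite -natrB ?subset_leq_card // -cardsDS //; congr _%:R.
  by apply: eq_card => a; rewrite in_setD [RHS]unfold_in /= andbT.
rewrite /pol [X in _ + X]big_split /= upE big_mkcondr /= -!big_split.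
apply: eq_bigr => S _ /=; rewrite /c1 /H inE.
case: (ltngtP #|S| d.+1) => [Sd|Sd|SE].
- by rewrite -ltnS Sd add0r addr0.
- by rewrite leqNgt (ltnW Sd) !addr0 cd // subsetT /= -ltnNge.
- by rewrite SE ltnn add0r subrK.
Qed.

End Harmonize.

(** * Functions on the slice as polynomials *)

Section Bridge.
Import mpoly.
Variables (R : realType) (n m : nat).
Implicit Types (A S : {set 'I_n}) (c F : {set 'I_n} -> R) (f h : slice n m -> R).
Implicit Types (x : slice n m) (P Q : {mpoly R[n]}) (mu : 'X_{1..n}).

Definition set_of x : {set 'I_n} := [set i | val x i].

Lemma set_of_level x : set_of x \in level [set: 'I_n] m.
Proof.
rewrite inE subsetT /= -(eqP (valP x)) -sum1_card big_mkcond /=.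
by apply/eqP/eq_bigr => i _; rewrite inE; case: (val x i).
Qed.

Lemma set_of_inj : injective set_of.
Proof.
move=> x y /setP E; apply: val_inj; apply/ffunP => i.
by have := E i; rewrite !inE.
Qed.

Lemma set_of_onto A : A \in level [set: 'I_n] m -> exists x, set_of x = A.
Proof.
rewrite inE subsetT /= => /eqP Am.
have Ax : (\sum_(i < n) [ffun i => i \in A] i == m)%N.
  rewrite -Am -sum1_card [eqbRHS]big_mkcond /=.
  by apply/eqP/eq_bigr => i _; rewrite ffunE; case: (i \in A).
by exists (Sub [ffun i => i \in A] Ax); apply/setP => i; rewrite inE SubK ffunE.
Qed.

Lemma sum_slice F :
  \sum_(x : slice n m) F (set_of x) = \sum_(A in level [set: 'I_n] m) F A.
Proof.
have -> : level [set: 'I_n] m = set_of @: setT.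
  apply/setP => A; apply/idP/imsetP => [/set_of_onto[x <-]|[x _ ->]].
    by exists x.
  exact: set_of_level.
by rewrite big_imset /= => [|x y _ _ /set_of_inj//]; apply: eq_bigl => x; rewrite inE.
Qed.

Lemma norm2_mean (g : slice n m -> R) F : (forall x, g x = F (set_of x)) ->
  norm2 g = mean [set: 'I_n] m (fun A => F A ^+ 2).
Proof.
move=> gF; rewrite /norm2 (eq_bigr _ (fun x _ => congr1 (fun t => t ^+ 2) (gF x))).
rewrite /mean (sum_slice (fun A => F A ^+ 2)); congr (_ / _%:R).
rewrite -(card_imset predT set_of_inj); apply: eq_card => A.
by apply/imsetP/idP => [[x _ ->]|/set_of_onto[x <-]]; [exact: set_of_level|exists x].
Qed.

Definition extend f A : R := oapp f 0 [pick x | set_of x == A].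

Lemma extendE f x : extend f (set_of x) = f x.
Proof.
rewrite /extend; case: pickP => [y /eqP/set_of_inj-> //|/(_ x)].
by rewrite eqxx.
Qed.

Definition mnm_set mu : {set 'I_n} := [set i | mu i != 0]%N.

Lemma card_mnm_set mu : (#|mnm_set mu| <= mdeg mu)%N.
Proof.
rewrite mdegE -sum1_card big_mkcond /=; apply: leq_sum => i _.
by rewrite inE; case: (mu i).
Qed.

Definition mnm_of S : 'X_{1..n} := [multinom (i \in S : nat) | i < n].

Lemma mnm_ofE S i : mnm_of S i = (i \in S).
Proof. exact: mnmE. Qed.

Lemma mnm_ofK S : mnm_set (mnm_of S) = S.
Proof. by apply/setP => i; rewrite inE mnm_ofE; case: (i \in S). Qed.

Lemma mdeg_mnm_of S : mdeg (mnm_of S) = #|S|.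
Proof.
rewrite mdegE -sum1_card [RHS]big_mkcond; apply: eq_bigr => i _.
by rewrite mnm_ofE; case: (i \in S).
Qed.

Lemma mnm_setK mu : (forall i, mu i <= 1)%N -> mnm_of (mnm_set mu) = mu.
Proof.
by move=> mu1; apply/mnmP => i; rewrite mnm_ofE inE; case: (mu i) (mu1 i) => [|[]].
Qed.

Lemma mnm_ofU1 S i : i \notin S -> (mnm_of S + U_(i))%MM = mnm_of (i |: S).
Proof.
move=> iS; apply/mnmP => j; rewrite mnmDE mnm1E !mnm_ofE in_setU1 eq_sym.
by have [->|_] := eqVneq j i; rewrite ?(negbTE iS) ?addn0.
Qed.

(** Coordinates are 0 or 1, so exponents count only through their support. *)
Lemma prod_coords x mu :
  \prod_i point_coords R x i ^+ mu i = (mnm_set mu \subset set_of x)%:R.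
Proof.
have [sub|/subsetPn[i]] := boolP (mnm_set mu \subset set_of x).
  apply: big1 => i _; rewrite /point_coords; have [->|mi] := eqVneq (mu i) 0%N.
    by rewrite expr0.
  have /(subsetP sub) : i \in mnm_set mu by rewrite inE.
  by rewrite inE => ->; rewrite expr1n.
rewrite !inE => mi /negbTE xi.
by rewrite (bigD1 i) //= /point_coords xi expr0n (negbTE mi) mul0r.
Qed.

Lemma meval_coords P x : eval_slice P x =
  \sum_(mu <- msupp P) P@_mu * (mnm_set mu \subset set_of x)%:R.
Proof.
by rewrite /eval_slice mevalE; apply: eq_bigr => mu _; rewrite prod_coords.
Qed.

(** [xget] returns a representative once one exists: interpolate [f], harmonize the coefficients and
    sum the squarefree monomials. *)
Lemma represents_harmonic_poly f : (m <= n - m)%N ->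
  represents (harmonic_poly f) f.
Proof.
move=> mn; rewrite /harmonic_poly;
apply: (@classical_sets.xgetPex _ 0
  (classical_sets.mkset (fun P => represents P f))).
have [c cd cE] := pol_onto [set: 'I_n] m (extend f).
have [c' [c'd c'h c'E]] := harmonize m cd.
pose P : {mpoly R[n]} := \sum_(S : {set 'I_n}) c' S *: 'X_[mnm_of S].
have PE mu : P@_mu = if mu == mnm_of (mnm_set mu) then c' (mnm_set mu) else 0.
  rewrite /P raddf_sum /= (bigD1 (mnm_set mu)) //= big1 ?addr0 => [|S Sm].
    by rewrite mcoeffZ mcoeffX eq_sym; case: eqP => _; rewrite ?mulr1 ?mulr0.
  rewrite mcoeffZ mcoeffX; case: eqP => [E|_]; last by rewrite mulr0.
  by rewrite -E mnm_ofK eqxx in Sm.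
have P0 mu i : (1 < mu i)%N -> P@_mu = 0.
  rewrite PE; case: eqP => // ->; rewrite mnmE; by case: (_ \in _).
exists P; split.
- move=> i; apply/mpolyP => mu; rewrite !mcoeff_deriv mcoeff0 (P0 _ i) ?mul0rn //.
  by rewrite !mnmDE !mnm1E eqxx !addn1.
- apply/mpolyP => mu; rewrite raddf_sum mcoeff0 /=.
  under eq_bigr do rewrite mcoeff_deriv.
  have [/existsP[j mj]|/existsPn small] := boolP [exists j, 1 < mu j]%N.
    apply: big1 => i _; rewrite (P0 _ j) ?mul0rn //.
    by rewrite mnmDE; apply: leq_trans mj _; apply: leq_addr.
  pose S := mnm_set mu.
  have muj i : mu i = (i \in S) by rewrite inE; have := small i; case: (mu i) => [|[]].
  apply: etrans (c'h S (subsetT S)); rewrite [RHS]big_mkcond; apply: eq_bigr => i _ /=.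
  rewrite inE /=; have [iS|iS] /= := boolP (i \in S).
    rewrite (P0 _ i) ?mul0rn // mnmDE mnm1E eqxx addn1 ltnS lt0n.
    by move: iS; rewrite inE.
  have -> : (mu i).+1 = 1%N by move: iS; rewrite inE negbK => /eqP->.
  rewrite -(mnm_setK (mu := mu)) => [|j]; last by rewrite leqNgt.
  rewrite mnm_ofU1 //.
  by rewrite PE mnm_ofK eqxx mulr1n.
- rewrite (minn_idPl mn); apply: (leq_trans (mmeasure_sum _ _ _ _)).
  apply/bigmax_leqP => S _;
  have [Sd|/c'd->] := boolP ((S \subset [set: 'I_n]) && (#|S| <= m)%N).
    apply: leq_trans (mmeasureZ_le _ _ _) _; rewrite mmeasureX ltnS.
    by have := mdeg_mnm_of S; case/andP: Sd => _ /[swap] <-.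
  by rewrite scale0r mmeasure0.
- move=> x; have xl := set_of_level x.
  rewrite -(extendE f) -cE // c'E // polE /eval_slice raddf_sum /=.
  by apply: eq_bigr => S _; rewrite mevalZ mevalX prod_coords mnm_ofK.
Qed.

(** What remains are the monomials of degree at most [k] of the harmonic polynomial; those with the
    same support agree on the slice, so their coefficients are added. *)
Lemma low_part_pol k f : (m <= n - m)%N -> exists2 c, deg_le [set: 'I_n] k c
  & forall x, f x - high_part k f x = pol c (set_of x).
Proof.
move=> /(represents_harmonic_poly f)[_ _ _ fE].
set P := harmonic_poly f in fE.
exists (fun S => \sum_(mu <- msupp P | (mdeg mu <= k)%N && (mnm_set mu == S)) P@_mu).
  move=> S; rewrite subsetT /= => Sk; apply: big1 => mu /andP[mk /eqP E].
  by case/negP: Sk; rewrite -E; apply: leq_trans mk; apply: card_mnm_set.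
move=> x; pose z mu : R := (mnm_set mu \subset set_of x)%:R.
have homE d : homog_part d f x = \sum_(mu <- msupp P | mdeg mu == d) P@_mu * z mu.
  rewrite /homog_part /eval_slice -/P pihomogE raddf_sum /=.
  by apply: eq_bigr => mu _; rewrite mevalZ mevalX prod_coords.
have highE : high_part k f x = \sum_(mu <- msupp P | (k < mdeg mu)%N) P@_mu * z mu.
  rewrite /high_part; under eq_bigr do rewrite homE big_mkcond.
  rewrite exchange_big /= [RHS]big_mkcond big_seq [RHS]big_seq.
  apply: eq_bigr => mu mP; case: ifP => km.
    (* [slice_degree] bounds the degree of every monomial of [P], so each one of degree above [k] is
       met exactly once. *)
    rewrite (bigD1_seq (mdeg mu)) ?iota_uniq //= ?eqxx; last first.
      rewrite mem_index_iota km ltnS /slice_degree -/P.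
      by have := msize_mdeg_lt mP; case: (msize P).
    by rewrite big1 ?addr0 // => d; rewrite eq_sym => /negbTE->.
  rewrite big_nat big1 // => d /andP[kd _]; case: eqP => // md.
  by rewrite md kd in km.
rewrite -fE meval_coords highE (bigID (fun mu => (k < mdeg mu)%N)) /= addrAC subrr add0r.
rewrite polE; under [RHS]eq_bigr do rewrite big_mkcond mulr_suml.
rewrite exchange_big /= big_mkcond; apply: eq_bigr => mu _; rewrite -leqNgt.
rewrite (bigD1 (mnm_set mu)) //= eqxx andbT big1 ?addr0.
  by case: ifP => // _; rewrite mul0r.
by move=> S; rewrite eq_sym => /negbTE->; rewrite andbF mul0r.
Qed.

(** Multilinearity leaves only squarefree monomials in the harmonic polynomial of [h], and
    [vanish_harmonic] kills their coefficients above degree [k]. *)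
Lemma slice_degree_vanish k h F : (m <= n - m)%N ->
    (forall x, h x = F (set_of x)) -> vanish k.+1 [set: 'I_n] m F ->
  (slice_degree h <= k)%N.
Proof.
move=> mn hF vF; have mn' : (m <= n)%N := leq_trans mn (leq_subr m n).
have [Pm Ph Pd hE] := represents_harmonic_poly h mn.
rewrite /slice_degree; set P := harmonic_poly h in Pm Ph Pd hE *.
pose c S := P@_(mnm_of S).
have P0 mu i : (1 < mu i)%N -> P@_mu = 0.
  move=> mi; have muE : (mu - U_(i) - U_(i) + U_(i) + U_(i))%MM = mu.
    apply/mnmP => j; rewrite !(mnmDE, mnmBE, mnm1E).
    by have [<-|_] := eqVneq i j; [clear -mi; lia | rewrite !subn0 !addn0].
  have /mpolyP/(_ (mu - U_(i) - U_(i))%MM) := Pm i.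
  rewrite !mcoeff_deriv mcoeff0 muE -mulrnA => /eqP; rewrite mulrn_eq0 /=.
  by move=> /eqP.
have cd : deg_le [set: 'I_n] (minn m (n - m)) c.
  move=> S; rewrite subsetT /= -ltnNge => Sd; apply: memN_msupp_eq0.
  apply: msize_mdeg_ge; rewrite mdeg_mnm_of; exact: leq_trans Pd Sd.
have ch : harmonic_on [set: 'I_n] c.
  move=> S _; have /mpolyP/(_ (mnm_of S)) := Ph; rewrite raddf_sum mcoeff0 /=.
  move=> E; apply: etrans E; rewrite [LHS]big_mkcond.
  apply: eq_bigr => i _ /=; rewrite mcoeff_deriv inE /=.
  have [iS|iS] /= := boolP (i \in S).
    by rewrite (P0 _ i) ?mul0rn // mnmDE mnm1E eqxx mnmE iS.
  by rewrite mnm_ofE (negbTE iS) mulr1n mnm_ofU1.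
have supp1 mu : mu \in msupp P -> mnm_of (mnm_set mu) = mu.
  move=> mP; apply: mnm_setK => i; rewrite leqNgt; apply: contraL mP => mi.
  by rewrite mcoeff_msupp (P0 _ i) ?eqxx.
have cE : {in level [set: 'I_n] m, pol c =1 F}.
  move=> A /set_of_onto[x <-]; rewrite -hF -hE meval_coords polE.
  transitivity (\sum_(S : {set 'I_n}) \sum_(mu <- msupp P)
      (if mnm_set mu == S then P@_mu * (mnm_set mu \subset set_of x)%:R else 0)).
    apply: eq_bigr => S _; have [SP|SP] := boolP (mnm_of S \in msupp P).
      rewrite (bigD1_seq (mnm_of S)) ?msupp_uniq //= mnm_ofK eqxx.
      rewrite big_seq_cond big1 ?addr0 // => mu /andP[mP mS].
      by case: eqP => // E; rewrite -E supp1 // eqxx in mS.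
    rewrite /c (memN_msupp_eq0 SP) mul0r big_seq big1 // => mu mP.
    by case: eqP => // E; rewrite -E supp1 // mP in SP.
  rewrite exchange_big; apply: eq_bigr => mu _ /=.
  rewrite (bigD1 (mnm_set mu)) //= eqxx big1 ?addr0 // => S.
  by rewrite eq_sym => /negbTE->.
have vc : vanish k.+1 [set: 'I_n] m (pol c).
  by apply: eq_vanish vF => A Am; rewrite cE.
have c0 := @vanish_harmonic _ _ m [set: 'I_n] k.+1 c.
rewrite cardsT card_ord in c0; have {}c0 := c0 mn' cd ch vc.
suff sk : (msize P <= k.+1)%N by rewrite -ltnS; case: (msize P) sk.
rewrite mmeasureE; apply/bigmax_leqP_seq => mu mP _; rewrite ltnNge.
apply/negP => km; move: (mP); rewrite mcoeff_msupp -(supp1 mu mP) => /eqP[].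
by apply: c0; rewrite -mdeg_mnm_of supp1.
Qed.

End Bridge.

(** * Approximation by a junta *)

Section Junta.
Variables (R : realType) (k n m : nat) (p : R) (f : slice n m -> R).
Hypotheses (n_gt0 : (0 < n)%N) (p_gt0 : 0 < p) (p_le : p <= 2^-1).
Hypothesis pn : p * n%:R = m%:R.
Hypothesis f_sign : sign_valued f.

Let m_half : (2 * m <= n)%N.
Proof.
rewrite -(ler_nat R) natrM -pn mulrA ler_piMl //.
by move: p_le; lra.
Qed.

Let m_co : (m <= n - m)%N. Proof. by clear -m_half; lia. Qed.
Let m_le : (m <= n)%N. Proof. by clear -m_half; lia. Qed.

Lemma vanish_cst (T : finType) j (W : {set T}) l (t : R) :
  vanish j.+1 W l (fun=> t).
Proof.
have v0 i V q (F : {set T} -> R) : F =1 (fun=> 0) -> vanish i V q F.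
  elim: i V q F => [|i IHi] V [|q] F F0 //= a b _ _ _.
  by apply: IHi => A; rewrite !F0 subrr.
by case: l => //= l a b _ _ _; apply: v0 => A; rewrite subrr.
Qed.

Lemma norm2_ge0 (g : slice n m -> R) : 0 <= norm2 g.
Proof. by rewrite divr_ge0 // sumr_ge0 // => x _; apply: sqr_ge0. Qed.

Lemma extend_sign : {in level [set: 'I_n] m, forall A, extend f A = 1 \/ extend f A = -1}.
Proof. by move=> A /set_of_onto[x <-]; rewrite extendE. Qed.

(** The fallback when the claimed error bound is at least 4, the largest squared distance between
    sign functions. *)
Lemma trivial_junta : exists h : slice n m -> R,
  [/\ sign_valued h, (slice_degree h <= k)%N,
      forall a : R, 0 <= a -> exists J : {set 'I_n}, #|J|%:R <= a /\ depends_on h J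
    & norm2 (fun x => f x - h x) <= 4].
Proof.
exists (fun=> 1); split; first by left.
- by apply: (@slice_degree_vanish _ _ _ k _ (fun=> 1)) => //; apply: vanish_cst.
- by move=> a a0; exists set0; rewrite cards0; split.
rewrite (@norm2_mean _ _ _ _ (fun A => extend f A - 1)) => [|x]; last by rewrite extendE.
rewrite -[leRHS](@mean_cst _ _ [set: 'I_n] m) ?cardsT ?card_ord //.
by apply: le_mean => A /extend_sign[]->; lra.
Qed.

(** [q] bounds the number of coordinates that get deleted or fixed. Its comparison with p n / 2
    keeps the density of what remains, and the last hypothesis puts the error after [k.+1]
    differences below the mass of any trace on the junta. *)
Lemma junta_of_small (eps q : R) (K := hyper_const k p) :
    norm2 (high_part k f) = eps -> 72 * K * eps <= 1 ->
    2 * k.+1%:R + 64 * k%:R * K <= q -> q <= p / 2 * n%:R ->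
    (forall w : nat, w%:R <= q -> 98 * 2 ^+ k.+1 * eps < (p / 2) ^+ w) ->
  exists h : slice n m -> R,
    [/\ sign_valued h, (slice_degree h <= k)%N,
      exists J : {set 'I_n}, #|J|%:R <= 64 * k%:R * K /\ depends_on h J
    & norm2 (fun x => f x - h x) <= 48 * eps].
Proof.
move=> fE eps_small Kq qn tiny; have [c cd cE] := low_part_pol k f m_co.
pose F := extend f; pose P := level [set: 'I_n] m.
have p01 : 0 < p <= 1 by rewrite p_gt0; move: p_le; lra.
have mT : (2 * m <= #|'I_n|)%N by rewrite card_ord.
have pT : p * #|'I_n|%:R <= m%:R by rewrite card_ord pn.
have near : mean [set: 'I_n] m (fun A => (F A - pol c A) ^+ 2) = eps.
  rewrite -fE (@norm2_mean _ _ _ _ (fun A => F A - pol c A)) // => x.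
  by rewrite /F extendE -cE opprB addrC subrK.
have near_le : mean [set: 'I_n] m (fun A => (F A - pol c A) ^+ 2) <= eps by rewrite near.
pose a0 : 'I_n := Ordinal n_gt0; pose J := core m eps F a0; pose v := vote m eps F a0.
have JK : #|J|%:R <= 64 * k%:R * K := card_core p01 mT pT cd extend_sign near_le eps_small a0.
have vote_near := mean_vote p01 mT pT cd extend_sign near_le eps_small a0.
exists (fun x => v (set_of x)); split.
- by move=> x; apply: vote_sign.
- apply: (@slice_degree_vanish _ _ _ k _ v) => //.
  pose N : R := #|P|%:R; have N0 : 0 < N by apply: card_level_gt0; rewrite cardsT card_ord.
  pose be := p / 2; have be0 : 0 < be by rewrite divr_gt0.
  (* Each of the [k.+1] differences deletes two coordinates, and the trace fixes at most |J|
     more. *)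
  pose w := (2 * k.+1 + #|J|)%N.
  have wq : w%:R <= q by rewrite natrD natrM; move: JK Kq; lra.
  apply: (@near_vanish _ _ _ _ _ _ c J (be ^+ w * N)).
  + by move=> A _; case: (vote_sign m eps F a0 A) => vA; rewrite /v vA ?rpredN rpred1.
  + by move=> A B AP BP AB; apply: vote_junta.
  + by move=> S kS; apply: cd; rewrite subsetT /= -ltnNge.
  + move=> W' m' X _; rewrite cardsT card_ord => W'n m'm Xl.
    have cp := card_pattern J Xl;
    apply: (@le_trans _ _ 'C(#|W' :\: J|, m' - #|X :&: J|)%:R);
      last by rewrite ler_nat.
    have XW : X \subset W' by move: Xl; rewrite inE => /andP[].
    have sJ : (#|X :&: J| <= #|W' :&: J|)%N by rewrite subset_leq_card // setSI.
    have WJ : (#|W' :&: J| <= #|J|)%N by rewrite subset_leq_card // subsetIr.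
    have WE := cardsID J W'.
    (* Of the deleted or fixed coordinates, [t] lie in the set and [u] outside. *)
    pose t := (k.+1 + #|X :&: J|)%N; pose u := (k.+1 + (#|W' :&: J| - #|X :&: J|))%N.
    have tw : (t <= w)%N by rewrite /t /w; clear -sJ WJ; lia.
    have uw : (u <= w)%N by rewrite /u /w; clear -sJ WJ; lia.
    have tuw : (t + u <= w)%N by rewrite /t /u /w; clear -sJ WJ; lia.
    have -> : (#|W' :\: J| = n - (t + u))%N by rewrite /t /u; clear -WE W'n sJ; lia.
    have -> : (m' - #|X :&: J| = m - t)%N by rewrite /t; clear -m'm; lia.
    have tq : t%:R <= be * n%:R by apply: le_trans qn; apply: le_trans wq; rewrite ler_nat.
    have uq : u%:R <= be * n%:R by apply: le_trans qn; apply: le_trans wq; rewrite ler_nat.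
    have bn : be * n%:R = m%:R / 2 by rewrite -pn /be; ring.
    have mn2 : 2 * m%:R <= n%:R :> R by rewrite -natrM ler_nat.
    apply: le_trans (bin_ratio (be := be) (t := t) (u := u) _ _ _).
    * rewrite /N card_level cardsT card_ord; apply: ler_wpM2r => //.
      by apply: ler_wiXn2l => //; [exact: ltW | rewrite /be; move: p_le; lra].
    * exact: ltW.
    * by move: tq; rewrite bn; lra.
    * by move: uq mn2; rewrite bn natrD; lra.
  (* 98 = 2 * 48 + 2, passing through [f]. *)
  have vc : \sum_(A in P) (v A - pol c A) ^+ 2 <= N * (98 * eps).
    rewrite sum_mean ?cardsT ?card_ord // ler_pM2l //.
    apply: (@le_trans _ _ (2 * mean [set: 'I_n] m (fun A => (F A - v A) ^+ 2)
      + 2 * mean [set: 'I_n] m (fun A => (F A - pol c A) ^+ 2))).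
      rewrite -!meanZ -meanD; apply: le_mean => A _.
      have := sqrD_le (v A - F A) (F A - pol c A).
      by rewrite addrA subrK -(sqrrN (F A - v A)) opprB.
    by rewrite near; move: vote_near; lra.
  apply: le_lt_trans (_ : 2 ^+ k.+1 * (N * (98 * eps)) < _).
    by apply: ler_wpM2l => //; apply: exprn_ge0.
  rewrite [ltLHS](_ : _ = 98 * 2 ^+ k.+1 * eps * N); last by ring.
  by rewrite ltr_pM2r // tiny.
- exists J; split=> // s sJ x y xy; apply: vote_junta; rewrite ?set_of_level //.
  apply/setP => i; rewrite !in_setI; case iJ: (i \in J); rewrite ?andbF ?andbT //.
  by rewrite !inE xy (out_perm sJ) // inE iJ.
- rewrite (@norm2_mean _ _ _ _ (fun A => F A - v A)) // => x.
  by rewrite /F extendE.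
Qed.

End Junta.

(* Continuity of the constants in p, and the final case distinction *)
From mathcomp Require Import all_classical all_reals all_analysis.
Import Order.TTheory GRing.Theory Num.Theory.
Import numFieldNormedType.Exports.
Local Open Scope classical_set_scope.
Local Open Scope ring_scope.

Lemma hyper_const_continuous (R : realType) k (p : R) : 0 < p ->
  {for p, continuous (hyper_const k : R -> R)}.
Proof.
elim: k p => [|k IHk] p p0; first exact: cvg_cst.
have uc : {for p, continuous
    (fun x : R => 1 + 4 * k.+1%:R * (hyper_const k (x / 2) / x))}; last first.
  exact: (cvgM uc uc).
apply: cvgD; first exact: cvg_cst.
apply: cvgM; first exact: cvg_cst.
apply: cvgM; last by apply: cvgV; [rewrite gt_eqF | exact: cvg_id].
apply: (@continuous_comp _ _ _ (fun x : R => x / 2) (hyper_const k)).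
  by apply: cvgM; [exact: cvg_id | exact: cvg_cst].
by apply: IHk; rewrite divr_gt0.
Qed.

(** exp(1/be) >= 1/be gives be^w >= exp(-w/be) >= exp(-q/be). Replacing the integer [w] by the real
    [q] makes the final constant continuous in p. *)
Lemma expR_pow_lt (R : realType) (be q t : R) (w : nat) : 0 < be -> w%:R <= q ->
  t * expR (q / be) < 1 -> t < be ^+ w.
Proof.
move=> be0 wq tq; have E0 : 0 < expR (q / be) by apply: expR_gt0.
rewrite -(ltr_pM2r E0); apply: lt_le_trans tq _.
have b1 : 1 <= be * expR (be^-1).
  rewrite -ler_pdivrMl // mulr1; apply: le_trans (expR_ge1Dx _).
  by rewrite lerDr.
apply: le_trans (_ : (be * expR (be^-1)) ^+ w <= _); first exact: exprn_ege1.
rewrite exprMn; apply: ler_wpM2l; first by rewrite exprn_ge0 // ltW.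
rewrite -expRM_natl ler_expR; apply: ler_wpM2r => //.
by rewrite invr_ge0 ltW.
Qed.

Theorem theorem8p5 (R : realType) :
  exists C : R, 0 < C /\
  forall k : nat, (2 <= k)%N ->
  exists A B : R -> R,
    {within `]0, 2^-1], continuous A} /\
    {within `]0, 2^-1], continuous B} /\
    forall (p : R), 0 < p <= 2^-1 ->
    forall (n m : nat), (0 < n)%N -> p * n%:R = m%:R ->
    forall (f : slice n m -> R) (eps : R),
      sign_valued f ->
      norm2 (high_part k f) = eps ->
      exists h : slice n m -> R,
        [/\ sign_valued h,
            (slice_degree h <= k)%N,
            (exists J : {set 'I_n}, #|J|%:R <= A p /\ depends_on h J) &
            norm2 (fun x => f x - h x) <=
              B p * (eps `^ C^-1 + (n%:R `^ C^-1)^-1)].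
Proof.
exists 1; split=> // k _.
pose A (p : R) : R := 64 * k%:R * hyper_const k p.
pose q (p : R) : R := 2 * k.+1%:R + A p.
pose E (p : R) : R := expR (q p * (2 / p)).
(* 48 comes from [junta_of_small]. Each summand in the bracket, times 4, lifts the bound to the
   trivial 4 when one of the three smallness conditions fails. *)
pose B (p : R) : R := 48 + 4 * (72 * hyper_const k p + 98 * 2 ^+ k.+1 * E p + q p * (2 / p)).
have within (g : R -> R) : (forall p : R, 0 < p -> {for p, continuous g}) ->
    {within `]0, 2^-1], continuous g}.
  move=> gc; apply: continuous_in_subspaceT => p.
  by rewrite inE /= in_itv /= => /andP[/gc].
have Kc p : 0 < p -> {for p, continuous (hyper_const k : R -> R)}.
  exact: hyper_const_continuous.
have Ac p : 0 < p -> {for p, continuous A}.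
  by move=> p0; apply: cvgM; [exact: cvg_cst | exact: Kc].
have qc p : 0 < p -> {for p, continuous (fun p => q p * (2 / p))}.
  move=> p0; apply: cvgM.
    by apply: cvgD; [exact: cvg_cst | exact: Ac].
  apply: cvgM; first exact: cvg_cst.
  by apply: cvgV; [rewrite gt_eqF | exact: cvg_id].
have Bc p : 0 < p -> {for p, continuous B}.
  move=> p0; apply: cvgD; first exact: cvg_cst.
  apply: cvgM; first exact: cvg_cst.
  apply: cvgD; last exact: qc.
  apply: cvgD; first by apply: cvgM; [exact: cvg_cst | exact: Kc].
  apply: cvgM; first exact: cvg_cst.
  by apply: (continuous_comp (qc p p0)); apply: continuous_expR.
exists A, B; split; first exact: within; split; first exact: within.
move=> p /andP[p0 p1] n m n0 pn f eps fs fE.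
have eps0 : 0 <= eps by rewrite -fE norm2_ge0.
have nR : 0 < n%:R :> R by rewrite ltr0n.
rewrite invr1 !powRr1 ?ler0n //.
have K0 : 0 <= hyper_const k p by apply: le_trans (hyper_const_ge1 k p0).
have A0 : 0 <= A p by rewrite !mulr_ge0.
have q0 : 0 <= q p * (2 / p) by rewrite mulr_ge0 ?addr_ge0 ?divr_ge0 // ?mulr_ge0 // ltW.
have E0 : 0 <= 98 * 2 ^+ k.+1 * E p by rewrite !mulr_ge0 ?exprn_ge0 // expR_ge0.
have in0 : 0 <= n%:R^-1 :> R by rewrite invr_ge0.
have [easy|] := boolP [|| 1 < 72 * hyper_const k p * eps,
    1 <= 98 * 2 ^+ k.+1 * E p * eps | p / 2 * n%:R < q p]; last first.
  rewrite !negb_or -leNgt -ltNge -leNgt => /and3P[h1 h2 h3].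
  have tiny (w : nat) : w%:R <= q p -> 98 * 2 ^+ k.+1 * eps < (p / 2) ^+ w.
    move=> wq; apply: expR_pow_lt wq _; first by rewrite divr_gt0.
    by rewrite mulrAC invf_div.
  have [h [hs hk hJ hf]] := junta_of_small n0 p0 p1 pn fs fE h1 (lexx _) h3 tiny.
  exists h; split=> //; apply: le_trans hf _.
  rewrite /B; move: K0 q0 E0; move: (hyper_const k p) (q p * _) (_ * E p) => x y z x0 y0 z0.
  apply: ler_pM => //; last by rewrite lerDl.
  by rewrite lerDl mulr_ge0 // !addr_ge0 // mulr_ge0.
have [h [hs hk hJ hf]] := trivial_junta k p1 pn fs.
exists h; split=> //; first exact: hJ.
apply: le_trans hf _.
have B4 t x : 0 <= x -> 1 <= t * x -> 0 <= t -> 4 * t <= B p -> 4 <= B p * x.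
  move=> x0 tx t0 tB; apply: le_trans (_ : 4 * t * x <= _); last exact: ler_wpM2r.
  by rewrite -mulrA ler_peMr.
have ineq : eps <= eps + n%:R^-1 /\ n%:R^-1 <= eps + n%:R^-1.
  by rewrite lerDl lerDr.
have K72 : 0 <= 72 * hyper_const k p by rewrite mulr_ge0.
case/or3P: easy => H.
- apply: (B4 (72 * hyper_const k p)) => //; first by rewrite addr_ge0.
  + by apply: le_trans (ltW H) _; apply: ler_wpM2l => //; case: ineq.
  + by rewrite /B; lra.
- apply: (B4 (98 * 2 ^+ k.+1 * E p)) => //; first by rewrite addr_ge0.
  + by apply: le_trans H _; apply: ler_wpM2l => //; case: ineq.
  + by rewrite /B; lra.
- apply: (B4 (q p * (2 / p))) => //; first by rewrite addr_ge0.
  (* The failed condition p n / 2 < q reads 1 < q (2 / p) / n. *)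
  + apply: le_trans (_ : q p * (2 / p) * n%:R^-1 <= _).
      rewrite ler_pdivlMr // mul1r mulrA ler_pdivlMr //.
      by move: H; lra.
    by apply: ler_wpM2l => //; case: ineq.
  + by rewrite /B; lra.
Qed.
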